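(* For $n=2^s$ with integer $s\ge 4$, let $\overline{L}_n := 2n\sin\frac{\pi}{2n}$ (an upper bound on the perimeter $L(P_n)$ of any convex small $n$-gon $P_n$), and let $M_n$ denote Mossinghoff's convex equilateral small $n$-gon (defined in the context). Then for every $n=2^s$ with integer $s\ge 4$ there exists a convex equilateral small $n$-gon $A_n$ such that, as $n\to\infty$ through powers of $2$, $$\overline{L}_n - L(A_n) = \frac{\pi^4}{n^4} + O\left(\frac{1}{n^5}\right)$$ and $$L(A_n) - L(M_n) = \frac{2\pi^4}{n^4} + O\left(\frac{1}{n^5}\right) > 0,$$ where the inequality $L(A_n)-L(M_n)>0$ is asserted for every $n=2^s$, $s\ge 4$.
   Context: Polygons are in the Euclidean plane. The diameter of a polygon is the largest distance between any pair of its vertices. A polygon is small if its diameter equals $1$. It is equilateral if all its sides have the same length. $L(P)$ denotes the perimeter of a polygon $P$. Definition of $M_n$ for $n=2^s$, $s\ge 4$. For $t\in(0,\pi/n)$ let $u_j(t)=(\sin jt,\cos jt)$. Let $j_1<j_2<\cdots<j_{3n/8}$ be the elements, in increasing order, of $\{1,2,\ldots,n/2-1\}\setminus\{4k+2 : 1\le k\le n/8-1\}$. Put $p_0=(0,0)$ and $$p_i = p_{i-1}+(-1)^{i-1}u_{j_i}(t),\qquad 1\le i\le 3n/8,$$ and $$q_k = p_{3k+2}+(-1)^k u_{4k+2}(t),\qquad 1\le k\le n/8-1.$$ Let $\rho(x,y)=(-x,y)$ be the reflection in the vertical axis. Let $t$ be the largest solution in $(0,\pi/n)$ of the equation $$\|p_{3n/8-1}-\rho(p_{3n/8})\|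 = 2\sin(t/2).$$ With this value of $t$, $M_n$ is the polygon whose $n$ vertices are $(0,0)$, $(0,1)$, the points $p_1,\ldots,p_{3n/8}$, the points $q_1,\ldots,q_{n/8-1}$, and the images under $\rho$ of all the points $p_i$ ($i\ge 1$) and $q_k$; it is the convex hull of these points. It is a convex equilateral small $n$-gon with side length $2\sin(t/2)$. *)

(* Defs.v *)
(* Stdlib real numbers. *)
From Stdlib Require Import Reals Arith List ClassicalEpsilon.
Open Scope R_scope.

Definition point : Type := (R * R)%type.

Definition dist (p q : point) : R := dist_euc (fst p) (snd p) (fst q) (snd q).

Definition padd (p q : point) : point := (fst p + fst q, snd p + snd q).
Definition pscale (c : R) (p : point) : point := (c * fst p, c * snd p).

(* Twice the signed area of the triangle abc; positive iff c lies strictly to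
   the left of the line directed from a to b. *)
Definition orient (a b c : point) : R :=
  (fst b - fst a) * (snd c - snd a) - (snd b - snd a) * (fst c - fst a).

(* An n-gon is given by its vertices P 0, ..., P (n-1) in boundary order;
   the values P i for i >= n are ignored by every notion below. *)
Definition polygon : Type := nat -> point.

Definition next (n i : nat) : nat := ((i + 1) mod n)%nat.

Definition side (n : nat) (P : polygon) (i : nat) : R :=
  dist (P i) (P (next n i)).

(* sum_f_R0 f m has the m + 1 terms f 0, ..., f m. *)
Definition perimeter (n : nat) (P : polygon) : R :=
  sum_f_R0 (side n P) (n - 1).

(* Vertices are listed counterclockwise, and every angle is less than PI: all
   vertices other than the ends of a side lie strictly to the left of it.  In
   particular the n vertices are pairwise distinct. *)
Definition convex_ngon (n : nat) (P : polygon) : Prop :=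
  (3 <= n)%nat /\
  forall i k : nat, (i < n)%nat -> (k < n)%nat -> k <> i -> k <> next n i ->
    0 < orient (P i) (P (next n i)) (P k).

Definition equilateral (n : nat) (P : polygon) : Prop :=
  exists l : R, forall i : nat, (i < n)%nat -> side n P i = l.

Definition is_diameter (n : nat) (P : polygon) (d : R) : Prop :=
  (exists i j : nat, (i < n)%nat /\ (j < n)%nat /\ dist (P i) (P j) = d) /\
  (forall i j : nat, (i < n)%nat -> (j < n)%nat -> dist (P i) (P j) <= d).

Definition small (n : nat) (P : polygon) : Prop := is_diameter n P 1.

Definition Lbar (n : nat) : R := 2 * INR n * sin (PI / (2 * INR n)).

Definition u (j : nat) (t : R) : point := (sin (INR j * t), cos (INR j * t)).

Definition removed (n j : nat) : bool :=
  existsb (fun k => (j =? 4 * k + 2)%nat) (seq 1 (n / 8 - 1)).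

Definition indices (n : nat) : list nat :=
  filter (fun j => negb (removed n j)) (seq 1 (n / 2 - 1)).

(* j_i is entry i - 1 of the increasing list, so p_(i+1) uses entry i. *)
Fixpoint p (n : nat) (t : R) (i : nat) : point :=
  match i with
  | O => (0, 0)
  | S i' => padd (p n t i') (pscale ((-1) ^ i') (u (nth i' (indices n) 0%nat) t))
  end.

Definition q (n : nat) (t : R) (k : nat) : point :=
  padd (p n t (3 * k + 2)) (pscale ((-1) ^ k) (u (4 * k + 2) t)).

Definition rho (x : point) : point := (- fst x, snd x).

Definition closing_eq (n : nat) (t : R) : Prop :=
  dist (p n t (3 * n / 8 - 1)) (rho (p n t (3 * n / 8))) = 2 * sin (t / 2).

Definition largest_solution (n : nat) (t : R) : Prop :=
  0 < t < PI / INR n /\ closing_eq n t /\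
  forall t' : R, 0 < t' < PI / INR n -> closing_eq n t' -> t' <= t.

Definition mossinghoff_vertex (n : nat) (t : R) (x : point) : Prop :=
  x = (0, 0) \/ x = (0, 1) \/
  (exists i : nat, (1 <= i <= 3 * n / 8)%nat /\
     (x = p n t i \/ x = rho (p n t i))) \/
  (exists k : nat, (1 <= k <= n / 8 - 1)%nat /\
     (x = q n t k \/ x = rho (q n t k))).

Definition is_mossinghoff (n : nat) (P : polygon) : Prop :=
  exists t : R, largest_solution n t /\ convex_ngon n P /\
    forall x : point,
      (exists i : nat, (i < n)%nat /\ P i = x) <-> mossinghoff_vertex n t x.

(* is_mossinghoff n determines the polygon up to the choice of the starting
   vertex, on which the perimeter does not depend. *)
Definition mossinghoff (n : nat) : polygon :=
  epsilon (inhabits (fun _ : nat => (0, 0))) (is_mossinghoff n).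

(* f(n) = O(g(n)) as n tends to infinity through the powers of 2. *)
Definition bigO_pow2 (f g : nat -> R) : Prop :=
  exists (C : R) (s0 : nat), forall s : nat, (s0 <= s)%nat ->
    Rabs (f (2 ^ s)%nat) <= C * Rabs (g (2 ^ s)%nat).

(* Main.v *)
(* Roll a unit segment: in each step it turns by [t] about one of its two ends.
   The positions of the ends are the vertices of a polygon with sides
   [2 sin (t/2)], up to two closing sides.  If these have the same length and
   [n t < PI], the polygon is convex because the directions of its sides turn
   monotonically, and its width in any direction is at most 1 because two
   parallel support lines touch either the two ends of one position of the
   segment or the ends of its extreme positions.

   A symmetric polygon is given by the word that says about which end each step
   turns, read from the axis outwards.  The word of A_n is the periodic
   repetition of the first eight letters of the Thue-Morse word, for which the
   closing sum telescopes; in the word of M_n the first two letters are changed.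

   With [beta = (PI - n t) / 2] and [kappa = 0] for A_n, [kappa = 2] for M_n,
   the closing equation becomes
   [2 beta = (1 + kappa) t^4 + O(t^5)], whereas the perimeter falls short of
   the bound by [2 beta + O(t^6)].  Moreover at the angle of M_n the closing
   expression of A_n is positive, and at [PI / n] it is negative, so A_n has the
   larger angle. *)
Require Import Defs.
From Stdlib Require Import Reals Lra Lia Arith List Bool.
From Stdlib Require Import ClassicalEpsilon FunctionalExtensionality.
Open Scope R_scope.

(** Write [Y] for the horizontal closing sum over [n / 2] steps. At [beta = 0] all terms of the
    closing expression without [Y] vanish, so [Y = 0] would give [t = PI / n], where the perimeter
    equals the bound. To leading order the equation reads [2 beta t = 2 Y (t^2 / 2)] with
    [Y = (1 + kappa) t^3], and the shortfall [2 n (sin (PI / (2 n)) - sin (t / 2))] is about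
    [PI - n t = 2 beta]. The size of [Y] thus decides everything, and the Thue-Morse signs are a
    product of difference operators that makes [Y] of third order. The obstacle is the definition of
    M_n, by a zigzag path with pendant points, a largest solution and a choice operator. The path
    has to be recognised as a rolling segment whose two ends take turns in carrying it. The chosen
    polygon is known only through its vertex set, which for convex polygons determines the sides.
    The largest solution is found in the window from [PI / (n + 2)] to [PI / n], where [beta] falls
    from [t] to 0 and the closing expression changes sign; a solution below the window is smaller
    anyway. *)

(** * Counting the letters of a word *)

Definition count (f : nat -> bool) (r : nat) : nat := length (filter f (seq 0 r)).

(* The [i]-th zero-based [r < M] with [f r]; the default value [M] stands for the final position. *)
Definition pick (f : nat -> bool) (M i : nat) : nat := nth i (filter f (seq 0 M)) M.

Lemma count_S f r : count f (S r) = (count f r + (if f r then 1 else 0))%nat.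
Proof.
  unfold count. rewrite seq_S, filter_app, length_app; simpl.
  destruct (f r); simpl; lia.
Qed.

Lemma count_mono f r r' : (r <= r')%nat -> (count f r <= count f r')%nat.
Proof. induction 1; [lia | rewrite count_S; lia]. Qed.

Lemma count_negb f r : (count f r + count (fun j => negb (f j)) r = r)%nat.
Proof.
  induction r as [|r IH]; [reflexivity |].
  rewrite !count_S; destruct (f r); simpl; lia.
Qed.

Lemma count_surj f M i :
  (i < count f M)%nat -> exists r, (r < M)%nat /\ f r = true /\ count f r = i.
Proof.
  induction M as [|M IH]; [unfold count; simpl; lia |].
  rewrite count_S; intros Hi.
  destruct (Nat.lt_ge_cases i (count f M)) as [H|H].
  - destruct (IH H) as (r & ? & ? & ?); exists r; repeat split; auto; lia.
  - exists M; destruct (f M); repeat split; lia.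
Qed.

Lemma nth_filter_seq (f : nat -> bool) (s L x d : nat) :
  (s <= x < s + L)%nat -> f x = true ->
  nth (length (filter f (seq s (x - s)))) (filter f (seq s L)) d = x.
Proof.
  intros Hx Hf.
  replace L with ((x - s) + S (s + L - x - 1))%nat by lia.
  rewrite seq_app, filter_app, app_nth2; [|lia].
  rewrite Nat.sub_diag. simpl.
  replace (s + (x - s))%nat with x by lia. now rewrite Hf.
Qed.

Lemma pick_spec f M i :
  (i < count f M)%nat ->
  (pick f M i < M)%nat /\ f (pick f M i) = true /\ count f (pick f M i) = i.
Proof.
  intros Hi. destruct (count_surj f M i Hi) as (r & Hr & Hf & Hc).
  assert (E : pick f M i = r).
  { unfold pick. rewrite <- Hc. unfold count.
    rewrite <- (Nat.sub_0_r r) at 1. apply nth_filter_seq; [lia | auto]. }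
  rewrite E; auto.
Qed.

Lemma pick_last f M : pick f M (count f M) = M.
Proof. unfold pick, count. now apply nth_overflow. Qed.

Lemma pick_le f M i : (i <= count f M)%nat -> (pick f M i <= M)%nat /\ count f (pick f M i) = i.
Proof.
  intros Hi. destruct (Nat.eq_dec i (count f M)) as [->|H].
  - rewrite pick_last; auto.
  - destruct (pick_spec f M i) as (? & ? & ?); [lia|]. split; auto; lia.
Qed.

(** Different counts mean that some step in between has letter [true]. This turns distinctness of
    vertices into strict inequalities between their projections. *)
Lemma chain_decr (F : nat -> R) (f : nat -> bool) (r1 r2 : nat) :
  (r1 <= r2)%nat ->
  (forall r, (r1 <= r < r2)%nat -> f r = true -> F (S r) < F r) ->
  (forall r, (r1 <= r < r2)%nat -> f r = false -> F (S r) = F r) ->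
  F r2 <= F r1 /\ (count f r1 <> count f r2 -> F r2 < F r1).
Proof.
  intros H; induction H as [|r2 H IH]; intros HT HF.
  - split; [lra | congruence].
  - destruct IH as [I1 I2].
    + intros; apply HT; auto; lia.
    + intros; apply HF; auto; lia.
    + pose proof (count_S f r2) as C. destruct (f r2) eqn:E.
      * specialize (HT r2 ltac:(lia) E). split; [lra | intros; lra].
      * rewrite (HF r2 ltac:(lia) E). split; [auto | intros; apply I2; lia].
Qed.

(** * The rolling segment and its support lines *)

Definition dir (x : R) : point := (sin x, cos x).

Definition proj (psi : R) (x : point) : R := fst x * sin psi + snd x * cos psi.

Definition opp (x : point) : point := (- fst x, - snd x).

(** Angles are measured clockwise from the vertical. [gamma] bisects the directions [alpha] before
    and after step [r], so it is normal to the side traced in that step, pointing outwards if [b]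
    moves and inwards if [a] moves. *)
Definition alpha (M : nat) (t : R) (r : nat) : R := (INR M / 2 - INR r) * t.
Definition gamma (M : nat) (t : R) (r : nat) : R := (INR M / 2 - INR r - 1 / 2) * t.

(* A diameter [a r, b r] of direction [alpha r] rolls around the polygon: in
   step [r] it turns by [t] about [a r] if [f r], and about [b r] otherwise.
   The last two fields say that it almost returns to its reversed initial
   position: the two closing sides have length [2 sin (t/2)]. *)
Record walk (M : nat) (t eta : R) (f : nat -> bool) (b a : nat -> point) : Prop := {
  w_t : 0 < t;
  w_M : (INR M / 2 + 1) * t < PI / 2;
  w_eta : - (t / 2) <= eta <= t / 2;
  w_diam : forall r, (r <= M)%nat -> b r = padd (a r) (dir (alpha M t r));
  w_true : forall r, (r < M)%nat -> f r = true -> a (S r) = a r;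
  w_false : forall r, (r < M)%nat -> f r = false -> b (S r) = b r;
  w_right : b 0%nat = padd (a M) (pscale (2 * sin (t / 2)) (dir eta));
  w_left : a 0%nat = padd (b M) (pscale (2 * sin (t / 2)) (sin eta, - cos eta))
}.

Lemma point_ext (x y : point) : fst x = fst y -> snd x = snd y -> x = y.
Proof. destruct x, y; simpl; intros; subst; auto. Qed.

(** A half-turn of the plane exchanges the two ends of the segment and complements the word. Every
    fact about [b] and the left closing side thereby yields one about [a] and the right closing
    side. *)
Lemma walk_dual M t eta f b a :
  walk M t eta f b a ->
  walk M t (- eta) (fun r => negb (f r)) (fun r => opp (a r)) (fun r => opp (b r)).
Proof.
  intros W; destruct W; constructor; auto.
  - lra.
  - intros r Hr. rewrite (w_diam0 r Hr). apply point_ext; simpl; ring.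
  - intros r Hr H. rewrite w_false0; auto. now destruct (f r).
  - intros r Hr H. rewrite w_true0; auto. now destruct (f r).
  - rewrite w_left0. apply point_ext; simpl; rewrite ?sin_neg, ?cos_neg; ring.
  - rewrite w_right0. apply point_ext; simpl; rewrite ?sin_neg, ?cos_neg; ring.
Qed.

Lemma sin_cos_sub (x y : R) :
  sin (x - y) - sin (x + y) = - (2 * sin y * cos x) /\
  cos (x - y) - cos (x + y) = 2 * sin y * sin x.
Proof. rewrite sin_minus, sin_plus, cos_minus, cos_plus; split; ring. Qed.

Lemma alpha_gamma M t r :
  alpha M t r = gamma M t r + t / 2 /\ alpha M t (S r) = gamma M t r - t / 2.
Proof. unfold alpha, gamma; rewrite S_INR; split; field. Qed.

Lemma step_b M t eta f b a r :
  walk M t eta f b a -> (r < M)%nat -> f r = true ->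
  b (S r) = padd (b r) (pscale (2 * sin (t / 2)) (- cos (gamma M t r), sin (gamma M t r))).
Proof.
  intros W Hr Hf.
  rewrite (w_diam _ _ _ _ _ _ W (S r)), (w_diam _ _ _ _ _ _ W r), (w_true _ _ _ _ _ _ W r) by (auto; lia).
  destruct (alpha_gamma M t r) as [-> ->].
  destruct (sin_cos_sub (gamma M t r) (t / 2)) as [H1 H2].
  apply point_ext; simpl; lra.
Qed.

Lemma proj_step_b M t eta f b a r psi :
  walk M t eta f b a -> (r < M)%nat -> f r = true ->
  proj psi (b (S r)) = proj psi (b r) + 2 * sin (t / 2) * sin (gamma M t r - psi).
Proof.
  intros W Hr Hf. rewrite (step_b _ _ _ _ _ _ _ W Hr Hf).
  unfold proj; simpl. rewrite sin_minus. ring.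
Qed.

Lemma half_side_pos M t eta f b a : walk M t eta f b a -> 0 < sin (t / 2).
Proof.
  intros W. pose proof (w_t _ _ _ _ _ _ W). pose proof (w_M _ _ _ _ _ _ W).
  pose proof (pos_INR M). apply sin_gt_0; nra.
Qed.

Lemma b_decr M t eta f b a psi r1 r2 :
  walk M t eta f b a -> (r1 <= r2 <= M)%nat ->
  (forall r, (r1 <= r < r2)%nat -> - PI < gamma M t r - psi < 0) ->
  proj psi (b r2) <= proj psi (b r1) /\
  (count f r1 <> count f r2 -> proj psi (b r2) < proj psi (b r1)).
Proof.
  intros W Hr Hs. pose proof (half_side_pos _ _ _ _ _ _ W) as Hl.
  apply (chain_decr (fun r => proj psi (b r)) f r1 r2); [lia | |].
  - intros r H Hf. rewrite (proj_step_b _ _ _ _ _ _ _ _ W) by (auto; lia).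
    specialize (Hs r H).
    assert (sin (gamma M t r - psi) < 0) by (apply sin_lt_0_var; lra). nra.
  - intros r H Hf. now rewrite (w_false _ _ _ _ _ _ W) by (auto; lia).
Qed.

Lemma b_incr M t eta f b a psi r1 r2 :
  walk M t eta f b a -> (r1 <= r2 <= M)%nat ->
  (forall r, (r1 <= r < r2)%nat -> 0 < gamma M t r - psi < PI) ->
  proj psi (b r1) <= proj psi (b r2) /\
  (count f r1 <> count f r2 -> proj psi (b r1) < proj psi (b r2)).
Proof.
  intros W Hr Hs. pose proof (half_side_pos _ _ _ _ _ _ W) as Hl.
  assert (H : - proj psi (b r2) <= - proj psi (b r1) /\
    (count f r1 <> count f r2 -> - proj psi (b r2) < - proj psi (b r1))).
  { apply (chain_decr (fun r => - proj psi (b r)) f r1 r2); [lia | |].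
    - intros r H Hf. rewrite (proj_step_b _ _ _ _ _ _ _ _ W) by (auto; lia).
      specialize (Hs r H).
      assert (0 < sin (gamma M t r - psi)) by (apply sin_gt_0; lra). nra.
    - intros r H Hf. now rewrite (w_false _ _ _ _ _ _ W) by (auto; lia). }
  destruct H as [H1 H2]; split; [lra | intros H; specialize (H2 H); lra].
Qed.

(** The weak form admits directions normal to a side, which cannot be excluded when the width is
    bounded in every direction. *)
Lemma b_decr_le M t eta f b a psi r1 r2 :
  walk M t eta f b a -> (r1 <= r2 <= M)%nat ->
  (forall r, (r1 <= r < r2)%nat -> - PI <= gamma M t r - psi <= 0) ->
  proj psi (b r2) <= proj psi (b r1).
Proof.
  intros W [H12 H2] Hs. pose proof (half_side_pos _ _ _ _ _ _ W) as Hl.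
  revert H2 Hs. induction H12 as [|r2 H12 IH]; intros H2 Hs; [lra|].
  apply Rle_trans with (proj psi (b r2)); [|apply IH; [lia | intros; apply Hs; lia]].
  destruct (f r2) eqn:E.
  - rewrite (proj_step_b _ _ _ _ _ _ _ _ W) by (auto; lia).
    specialize (Hs r2 ltac:(lia)).
    assert (0 <= sin (- (gamma M t r2 - psi))) by (apply sin_ge_0; lra).
    rewrite sin_neg in H. nra.
  - rewrite (w_false _ _ _ _ _ _ W) by (auto; lia). lra.
Qed.

Lemma b_incr_le M t eta f b a psi r1 r2 :
  walk M t eta f b a -> (r1 <= r2 <= M)%nat ->
  (forall r, (r1 <= r < r2)%nat -> 0 <= gamma M t r - psi <= PI) ->
  proj psi (b r1) <= proj psi (b r2).
Proof.
  intros W [H12 H2] Hs. pose proof (half_side_pos _ _ _ _ _ _ W) as Hl.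
  revert H2 Hs. induction H12 as [|r2 H12 IH]; intros H2 Hs; [lra|].
  apply Rle_trans with (proj psi (b r2)); [apply IH; [lia | intros; apply Hs; lia]|].
  destruct (f r2) eqn:E.
  - rewrite (proj_step_b _ _ _ _ _ _ _ _ W) by (auto; lia).
    specialize (Hs r2 ltac:(lia)).
    assert (0 <= sin (gamma M t r2 - psi)) by (apply sin_ge_0; lra). nra.
  - rewrite (w_false _ _ _ _ _ _ W) by (auto; lia). lra.
Qed.

Lemma proj_opp psi x : proj psi (opp x) = - proj psi x.
Proof. unfold proj; simpl; ring. Qed.

Lemma a_decr_le M t eta f b a psi r1 r2 :
  walk M t eta f b a -> (r1 <= r2 <= M)%nat ->
  (forall r, (r1 <= r < r2)%nat -> 0 <= gamma M t r - psi <= PI) ->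
  proj psi (a r2) <= proj psi (a r1).
Proof.
  intros W Hr Hs.
  pose proof (b_incr_le _ _ _ _ _ _ psi r1 r2 (walk_dual _ _ _ _ _ _ W) Hr Hs) as H.
  cbv beta in H. rewrite !proj_opp in H. lra.
Qed.

Lemma a_incr_le M t eta f b a psi r1 r2 :
  walk M t eta f b a -> (r1 <= r2 <= M)%nat ->
  (forall r, (r1 <= r < r2)%nat -> - PI <= gamma M t r - psi <= 0) ->
  proj psi (a r1) <= proj psi (a r2).
Proof.
  intros W Hr Hs.
  pose proof (b_decr_le _ _ _ _ _ _ psi r1 r2 (walk_dual _ _ _ _ _ _ W) Hr Hs) as H.
  cbv beta in H. rewrite !proj_opp in H. lra.
Qed.

Lemma gamma_bound M t eta f b a r :
  walk M t eta f b a -> (r < M)%nat ->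
  - (INR M / 2 - 1 / 2) * t <= gamma M t r <= (INR M / 2 - 1 / 2) * t.
Proof.
  intros W Hr. pose proof (w_t _ _ _ _ _ _ W). unfold gamma.
  apply lt_INR in Hr as Hr'. pose proof (pos_INR r).
  assert (INR r + 1 <= INR M) by (rewrite <- S_INR; apply le_INR; lia).
  split; nra.
Qed.

Lemma gamma_lt M t r r' : 0 < t -> (r < r')%nat -> gamma M t r' <= gamma M t r - t.
Proof.
  intros Ht H. unfold gamma.
  assert (INR r + 1 <= INR r') by (rewrite <- S_INR; apply le_INR; lia). nra.
Qed.

(* The closing sides descend towards [a] in every direction within
   [(M/2 + 1/2) t] of the vertical, because [nt/2 = (M/2 + 1) t < PI/2]. *)
Lemma a_ends_below M t eta f b a psi :
  walk M t eta f b a ->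
  - (INR M / 2 + 1 / 2) * t <= psi <= (INR M / 2 + 1 / 2) * t ->
  proj psi (a M) < proj psi (b 0%nat) /\ proj psi (a 0%nat) < proj psi (b M).
Proof.
  intros W Hpsi. pose proof (half_side_pos _ _ _ _ _ _ W) as Hl.
  pose proof (w_t _ _ _ _ _ _ W). pose proof (w_M _ _ _ _ _ _ W).
  pose proof (w_eta _ _ _ _ _ _ W). pose proof (pos_INR M).
  rewrite (w_right _ _ _ _ _ _ W), (w_left _ _ _ _ _ _ W). unfold proj; simpl.
  assert (0 < cos (psi - eta)) by (apply cos_gt_0; nra).
  assert (0 < cos (psi + eta)) by (apply cos_gt_0; nra).
  rewrite cos_minus in H3. rewrite cos_plus in H4. split; nra.
Qed.

(** The projection of [b] is largest at [r0], while that of [a] first falls and then rises, hence is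
    largest at [a 0] or [a M]. These lie below [b M] and [b 0] respectively, by the closing
    sides. *)
Lemma a_below M t eta f b a psi r0 r :
  walk M t eta f b a -> (r0 <= M)%nat -> (r <= M)%nat ->
  - (INR M / 2 + 1 / 2) * t <= psi <= (INR M / 2 + 1 / 2) * t ->
  (forall r, (r < r0)%nat -> 0 <= gamma M t r - psi <= PI) ->
  (forall r, (r0 <= r < M)%nat -> - PI <= gamma M t r - psi <= 0) ->
  proj psi (a r) < proj psi (b r0).
Proof.
  intros W Hr0 Hr Hpsi Hu Hd.
  destruct (a_ends_below _ _ _ _ _ _ psi W Hpsi) as [E1 E2].
  assert (B1 := b_incr_le _ _ _ _ _ _ psi 0 r0 W ltac:(lia) ltac:(intros; apply Hu; lia)).
  assert (B2 := b_decr_le _ _ _ _ _ _ psi r0 M W ltac:(lia) ltac:(intros; apply Hd; lia)).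
  destruct (Nat.le_gt_cases r r0) as [H|H].
  - assert (A := a_decr_le _ _ _ _ _ _ psi 0 r W ltac:(lia) ltac:(intros; apply Hu; lia)). lra.
  - assert (A := a_incr_le _ _ _ _ _ _ psi r M W ltac:(lia) ltac:(intros; apply Hd; lia)). lra.
Qed.

Lemma orient_proj P l g x :
  orient P (padd P (pscale l (- cos g, sin g))) x = l * (proj g P - proj g x).
Proof. unfold orient, proj; simpl; ring. Qed.

(** Since [b] rests in all steps with letter [false], [count f r] serves as the number of the vertex
    [b r]. *)
Lemma b_count M t eta f b a r r' :
  walk M t eta f b a -> (r <= M)%nat -> (r' <= M)%nat -> count f r = count f r' ->
  b r = b r'.
Proof.
  intros W.
  assert (K : forall r d, (r + d <= M)%nat -> count f r = count f (r + d) -> b r = b (r + d)%nat).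
  { intros s d; induction d as [|d IH]; intros Hd Hc.
    - now rewrite Nat.add_0_r.
    - rewrite Nat.add_succ_r in *. rewrite count_S in Hc.
      pose proof (count_mono f s (s + d) ltac:(lia)).
      destruct (f (s + d)%nat) eqn:E; [lia|].
      rewrite (w_false _ _ _ _ _ _ W) by (auto; lia). apply IH; lia. }
  intros Hr Hr' Hc. destruct (Nat.le_ge_cases r r').
  - replace r' with (r + (r' - r))%nat in * by lia. apply K; auto.
  - replace r with (r' + (r - r'))%nat in * by lia. symmetry. apply K; auto.
Qed.

(** The side is orthogonal to [dir (gamma M t r0)], so its orientations are differences of
    projections in that direction. The projections of [b] increase strictly before the side and
    decrease strictly after it; those of [a] are smaller by [a_below]. *)
Lemma orient_edge_b M t eta f b a r0 :
  walk M t eta f b a -> (r0 < M)%nat -> f r0 = true ->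
  (forall r, (r <= M)%nat -> count f r <> count f r0 -> count f r <> S (count f r0) ->
     0 < orient (b r0) (b (S r0)) (b r)) /\
  (forall r, (r <= M)%nat -> 0 < orient (b r0) (b (S r0)) (a r)).
Proof.
  intros W Hr0 Hf.
  pose proof (half_side_pos _ _ _ _ _ _ W) as Hl.
  pose proof (w_t _ _ _ _ _ _ W) as Ht. pose proof (w_M _ _ _ _ _ _ W) as HM.
  pose proof (gamma_bound _ _ _ _ _ _ r0 W Hr0) as G0.
  assert (E : proj (gamma M t r0) (b (S r0)) = proj (gamma M t r0) (b r0)).
  { rewrite (proj_step_b _ _ _ _ _ _ _ _ W) by auto.
    rewrite Rminus_diag, sin_0. ring. }
  assert (O : forall x, proj (gamma M t r0) x < proj (gamma M t r0) (b r0) ->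
                0 < orient (b r0) (b (S r0)) x).
  { intros x Hx. rewrite (step_b _ _ _ _ _ _ _ W) by auto. rewrite orient_proj. nra. }
  assert (Up : forall r, (r < r0)%nat -> 0 < gamma M t r - gamma M t r0 < PI).
  { intros r Hr. pose proof (gamma_lt M t _ _ Ht Hr).
    pose proof (gamma_bound _ _ _ _ _ _ r W ltac:(lia)). split; nra. }
  assert (Dn : forall r, (S r0 <= r < M)%nat -> - PI < gamma M t r - gamma M t r0 < 0).
  { intros r Hr. pose proof (gamma_lt M t r0 r Ht ltac:(lia)).
    pose proof (gamma_bound _ _ _ _ _ _ r W ltac:(lia)). split; nra. }
  split.
  - intros r Hr H1 H2. apply O.
    destruct (Nat.le_gt_cases r r0) as [H|H].
    + apply (b_incr _ _ _ _ _ _ (gamma M t r0) r r0 W); auto; try lia.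
      intros; apply Up; lia.
    + rewrite <- E. apply (b_decr _ _ _ _ _ _ (gamma M t r0) (S r0) r W); auto; try lia.
      * intros; apply Dn; lia.
      * rewrite count_S, Hf. lia.
  - intros r Hr. apply O.
    apply (a_below _ _ _ _ _ _ _ r0 r W); [lia | lia | split; nra | |].
    + intros s Hs. pose proof (Up s Hs). lra.
    + intros s Hs. destruct (Nat.eq_dec s r0) as [->|Hn].
      * pose proof PI_RGT_0. lra.
      * pose proof (Dn s ltac:(lia)). lra.
Qed.

Lemma orient_closing M t eta f b a :
  walk M t eta f b a ->
  (forall r, (r <= M)%nat -> count f r <> count f M -> 0 < orient (b M) (a 0%nat) (b r)) /\
  (forall r, (r <= M)%nat -> count (fun j => negb (f j)) r <> 0%nat ->
     0 < orient (b M) (a 0%nat) (a r)).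
Proof.
  intros W.
  pose proof (half_side_pos _ _ _ _ _ _ W) as Hl.
  pose proof (w_t _ _ _ _ _ _ W) as Ht. pose proof (w_M _ _ _ _ _ _ W) as HM.
  pose proof (w_eta _ _ _ _ _ _ W) as He. pose proof (pos_INR M) as HM0.
  (* The outward normal of the left closing side. As [|gamma + eta| <= M t / 2 < PI / 2], every step
     lies on the same side of it: [b] rises towards [b M], and [a] descends from [a 0]. *)
  set (psi := - (PI / 2) - eta).
  assert (Ha : a 0%nat = padd (b M) (pscale (2 * sin (t / 2)) (- cos psi, sin psi))).
  { rewrite (w_left _ _ _ _ _ _ W). unfold psi.
    replace (- (PI / 2) - eta) with (- (PI / 2 + eta)) by ring.
    rewrite cos_neg, sin_neg, <- cos_sin.
    replace (PI / 2 + eta) with (PI / 2 - - eta) by ring.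
    rewrite cos_shift, sin_neg. apply point_ext; simpl; ring. }
  assert (Ea : proj psi (a 0%nat) = proj psi (b M)).
  { rewrite Ha. unfold proj; simpl. ring. }
  assert (O : forall x, proj psi x < proj psi (b M) -> 0 < orient (b M) (a 0%nat) x).
  { intros x Hx. rewrite Ha, orient_proj. nra. }
  assert (Up : forall r, (r < M)%nat -> 0 < gamma M t r - psi < PI).
  { intros r Hr. pose proof (gamma_bound _ _ _ _ _ _ r W Hr). unfold psi. split; nra. }
  split.
  - intros r Hr Hc. apply O.
    apply (b_incr _ _ _ _ _ _ psi r M W); auto; try lia. intros; apply Up; lia.
  - intros r Hr Hc. apply O. rewrite <- Ea.
    destruct (b_incr _ _ _ _ _ _ psi 0 r (walk_dual _ _ _ _ _ _ W)) as [_ H]; try lia.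
    + intros; apply Up; lia.
    + rewrite !proj_opp in H. cut (- proj psi (a 0%nat) < - proj psi (a r)); [lra|].
      apply H. unfold count at 1; simpl. lia.
Qed.

(** * The polygon traced by a walk *)

Lemma orient_opp x y z : orient (opp x) (opp y) (opp z) = orient x y z.
Proof. unfold orient; simpl; ring. Qed.

(* Counterclockwise: the distinct points [b r], then the distinct points [a r]. *)
Definition ngon (M : nat) (f : nat -> bool) (b a : nat -> point) : polygon :=
  fun i => if (i <=? count f M)%nat then b (pick f M i)
           else a (pick (fun j => negb (f j)) M (i - count f M - 1)).

Lemma ngon_b M f b a i :
  (i <= count f M)%nat -> ngon M f b a i = b (pick f M i).
Proof. intros H. unfold ngon. apply Nat.leb_le in H. now rewrite H. Qed.

Lemma ngon_a M f b a i :
  ngon M f b a (count f M + 1 + i)%nat = a (pick (fun j => negb (f j)) M i).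
Proof.
  unfold ngon. destruct (Nat.leb_spec (count f M + 1 + i) (count f M)); [lia|].
  now replace (count f M + 1 + i - count f M - 1)%nat with i by lia.
Qed.

Lemma ngon_b_rep M t eta f b a r :
  walk M t eta f b a -> (r <= M)%nat -> ngon M f b a (count f r) = b r.
Proof.
  intros W Hr. pose proof (count_mono f r M Hr) as Hc.
  rewrite ngon_b by auto. destruct (pick_le f M (count f r) Hc).
  eapply b_count; eauto.
Qed.

Lemma a_count M t eta f b a r r' :
  walk M t eta f b a -> (r <= M)%nat -> (r' <= M)%nat ->
  count (fun j => negb (f j)) r = count (fun j => negb (f j)) r' -> a r = a r'.
Proof.
  intros W Hr Hr' Hc.
  pose proof (b_count _ _ _ _ _ _ r r' (walk_dual _ _ _ _ _ _ W) Hr Hr' Hc) as H.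
  unfold opp in H. injection H; intros. apply point_ext; lra.
Qed.

Lemma ngon_a_rep M t eta f b a r :
  walk M t eta f b a -> (r <= M)%nat ->
  ngon M f b a (count f M + 1 + count (fun j => negb (f j)) r)%nat = a r.
Proof.
  intros W Hr. pose proof (count_mono (fun j => negb (f j)) r M Hr) as Hc.
  rewrite ngon_a. destruct (pick_le (fun j => negb (f j)) M _ Hc).
  eapply a_count; eauto.
Qed.

(** Writing an index as the number of a position lets the geometry be argued in terms of [r],
    without [pick]. *)
Inductive index_cases (M : nat) (f : nat -> bool) : nat -> Prop :=
| index_b r : (r <= M)%nat -> index_cases M f (count f r)
| index_a r : (r <= M)%nat ->
    index_cases M f (count f M + 1 + count (fun j => negb (f j)) r)%nat.

Lemma index_casesP M f i : (i < M + 2)%nat -> index_cases M f i.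
Proof.
  intros Hi. pose proof (count_negb f M).
  destruct (Nat.le_gt_cases i (count f M)) as [H0|H0].
  - destruct (pick_le f M i H0) as [H1 H2]. rewrite <- H2. now constructor.
  - destruct (pick_le (fun j => negb (f j)) M (i - count f M - 1) ltac:(lia)) as [H1 H2].
    replace i with (count f M + 1 + (i - count f M - 1))%nat by lia.
    rewrite <- H2. now constructor.
Qed.

(** One side for each of the [M] steps, and two closing sides. The counts at 0 are left unevaluated
    so that all endpoints have the form that [ngon_b_rep] and [ngon_a_rep] rewrite. *)
Inductive side_cases (M : nat) (f : nat -> bool) : nat -> nat -> Prop :=
| side_b r : (r < M)%nat -> f r = true ->
    side_cases M f (count f r) (count f (S r))
| side_left : side_cases M f (count f M)
    (count f M + 1 + count (fun j => negb (f j)) 0)%nat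
| side_a r : (r < M)%nat -> f r = false ->
    side_cases M f (count f M + 1 + count (fun j => negb (f j)) r)%nat
      (count f M + 1 + count (fun j => negb (f j)) (S r))%nat
| side_right : side_cases M f (count f M + 1 + count (fun j => negb (f j)) M)%nat (count f 0).

Lemma side_casesP M f i : (i < M + 2)%nat -> side_cases M f i (next (M + 2) i).
Proof.
  intros Hi. pose proof (count_negb f M). unfold next.
  destruct (Nat.eq_dec i (M + 1)) as [->|Hn].
  - replace (M + 1 + 1)%nat with (M + 2)%nat by lia. rewrite Nat.Div0.mod_same.
    replace (M + 1)%nat with (count f M + 1 + count (fun j => negb (f j)) M)%nat by lia.
    apply (side_right M f).
  - rewrite Nat.mod_small by lia.
    destruct (lt_eq_lt_dec i (count f M)) as [[H0|H0]|H0].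
    + destruct (pick_spec f M i H0) as (H1 & H2 & H3).
      pose proof (side_b M f _ H1 H2) as S. rewrite count_S, H2, H3 in S. exact S.
    + subst i. pose proof (side_left M f) as S. unfold count at 3 in S. simpl in S.
      now rewrite Nat.add_0_r in S.
    + destruct (pick_spec (fun j => negb (f j)) M (i - count f M - 1) ltac:(lia)) as (H1 & H2 & H3).
      pose proof (side_a M f _ H1 ltac:(now apply negb_true_iff)) as S.
      rewrite count_S, H2, H3 in S.
      replace (count f M + 1 + (i - count f M - 1))%nat with i in S by lia.
      replace (count f M + 1 + (i - count f M - 1 + 1))%nat with (i + 1)%nat in S by lia.
      exact S.
Qed.

Lemma ngon_convex M t eta f b a :
  walk M t eta f b a -> (1 <= M)%nat -> convex_ngon (M + 2) (ngon M f b a).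
Proof.
  intros W HM. split; [lia|]. intros i k Hi Hk. pose proof (walk_dual _ _ _ _ _ _ W) as W'.
  generalize (next (M + 2) i) (side_casesP M f i Hi).
  intros j Hs. destruct (index_casesP M f k Hk) as [r Hr|r Hr]; destruct Hs as [s Hs Hf| |s Hs Hf|];
    intros N1 N2; rewrite ?(ngon_b_rep _ _ _ _ _ _ _ W), ?(ngon_a_rep _ _ _ _ _ _ _ W) by (auto; lia).
  - apply (orient_edge_b _ _ _ _ _ _ s W); auto. rewrite count_S, Hf in N2. lia.
  - now apply (orient_closing _ _ _ _ _ _ W).
  - rewrite <- orient_opp. apply (orient_edge_b _ _ _ _ _ _ s W'); auto. now rewrite Hf.
  (* The right closing side is the left one of the dual walk; its word negated once more is the
     original one. *)
  - rewrite <- orient_opp. apply (orient_closing _ _ _ _ _ _ W'); auto.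
    intros E. apply N2. unfold count at 2; simpl. rewrite <- E.
    unfold count. f_equal. apply filter_ext. intros x; now destruct (f x).
  - apply (orient_edge_b _ _ _ _ _ _ s W); auto.
  - apply (orient_closing _ _ _ _ _ _ W); auto.
  - rewrite <- orient_opp.
    apply (orient_edge_b _ _ _ _ _ _ s W'); auto; try lia.
    + now rewrite Hf.
    + rewrite (count_S (fun j => negb (f j))), Hf in N2. simpl in N2. lia.
  - rewrite <- orient_opp. apply (orient_closing _ _ _ _ _ _ W'); auto.
Qed.

Lemma dist_padd x l c s : 0 <= l -> c * c + s * s = 1 -> Defs.dist x (padd x (pscale l (c, s))) = l.
Proof.
  intros Hl H. unfold Defs.dist, dist_euc; simpl.
  transitivity (sqrt (Rsqr l)); [|now apply sqrt_Rsqr].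
  f_equal. unfold Rsqr. transitivity (l * l * (c * c + s * s)); [ring | rewrite H; ring].
Qed.

Lemma dist_opp x y : Defs.dist (opp x) (opp y) = Defs.dist x y.
Proof. unfold Defs.dist, dist_euc; simpl. f_equal. unfold Rsqr; ring. Qed.

Lemma sq_sin_cos x : sin x * sin x + cos x * cos x = 1.
Proof. pose proof (sin2_cos2 x) as H. unfold Rsqr in H. exact H. Qed.

Lemma ngon_side M t eta f b a i :
  walk M t eta f b a -> (i < M + 2)%nat ->
  side (M + 2) (ngon M f b a) i = 2 * sin (t / 2).
Proof.
  intros W Hi. unfold side. pose proof (walk_dual _ _ _ _ _ _ W) as W'.
  pose proof (half_side_pos _ _ _ _ _ _ W) as Hl.
  destruct (side_casesP M f i Hi) as [s Hs Hf| |s Hs Hf|];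
    rewrite ?(ngon_b_rep _ _ _ _ _ _ _ W), ?(ngon_a_rep _ _ _ _ _ _ _ W) by (auto; lia).
  - rewrite (step_b _ _ _ _ _ _ _ W) by auto.
    apply dist_padd; [lra|]. pose proof (sq_sin_cos (gamma M t s)); lra.
  - rewrite (w_left _ _ _ _ _ _ W). apply dist_padd; [lra|].
    pose proof (sq_sin_cos eta); lra.
  - rewrite <- dist_opp, (step_b _ _ _ _ _ _ _ W') by (auto; now rewrite Hf).
    apply dist_padd; [lra|]. pose proof (sq_sin_cos (gamma M t s)); lra.
  - rewrite (w_right _ _ _ _ _ _ W). apply dist_padd; [lra|].
    apply sq_sin_cos.
Qed.

Lemma ngon_vertices M t eta f b a x :
  walk M t eta f b a ->
  (exists i, (i < M + 2)%nat /\ ngon M f b a i = x) <->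
  (exists r, (r <= M)%nat /\ (b r = x \/ a r = x)).
Proof.
  intros W. split.
  - intros (i & Hi & <-).
    destruct (index_casesP M f i Hi) as [r Hr|r Hr];
      rewrite ?(ngon_b_rep _ _ _ _ _ _ _ W), ?(ngon_a_rep _ _ _ _ _ _ _ W) by (auto; lia); eauto.
  - pose proof (count_negb f M).
    intros (r & Hr & [<-|<-]).
    + exists (count f r). pose proof (count_mono f r M Hr). split; [lia|].
      eapply ngon_b_rep; eauto.
    + exists (count f M + 1 + count (fun j => negb (f j)) r)%nat.
      pose proof (count_mono (fun j => negb (f j)) r M Hr). split; [lia|].
      eapply ngon_a_rep; eauto.
Qed.

(** * Width and diameter *)

(** Comparing heights gives [2 sin (t/2) cos eta = cos x] with [x = M t / 2], so both vectors are
    horizontal. Their lengths are at most [2 sin (t/2) |sin eta| + sin x <= 2 sin (t/2)^2 + cos t =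
    1], using [|eta| <= t/2] and [x + t < PI/2]. *)
Lemma walk_extremes M t eta f b a :
  walk M t eta f b a ->
  (exists x, -1 <= x <= 1 /\ b 0%nat = padd (b M) (x, 0)) /\
  (exists x, -1 <= x <= 1 /\ a M = padd (a 0%nat) (x, 0)).
Proof.
  intros W. pose proof (half_side_pos _ _ _ _ _ _ W) as Hl.
  destruct W as [Ht HM He Hd _ _ Hr Hlft].
  pose proof (pos_INR M) as HM0.
  pose proof (Hd 0%nat ltac:(lia)) as D0. pose proof (Hd M ltac:(lia)) as DM.
  unfold alpha in D0, DM. simpl (INR 0) in D0.
  replace ((INR M / 2 - 0) * t) with (INR M / 2 * t) in D0 by ring.
  replace ((INR M / 2 - INR M) * t) with (- (INR M / 2 * t)) in DM by field.
  set (x := INR M / 2 * t) in *.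
  assert (Hx : 0 <= x) by (unfold x; nra).
  assert (Hxt : x + t < PI / 2) by (unfold x; lra).
  clearbody x. pose proof PI_RGT_0.
  assert (Sx : sin x <= cos t).
  { rewrite <- sin_shift. apply sin_incr_1; lra. }
  assert (S0 : 0 <= sin x) by (apply sin_ge_0; lra).
  assert (Se : - sin (t / 2) <= sin eta <= sin (t / 2)).
  { rewrite <- sin_neg. split; apply sin_incr_1; lra. }
  assert (Ct : cos t = 1 - 2 * sin (t / 2) * sin (t / 2)).
  { rewrite <- cos_2a_sin. f_equal; field. }
  assert (St : sin (t / 2) <= 1) by apply SIN_bound.
  assert (Y : 2 * sin (t / 2) * cos eta = cos x).
  { apply (f_equal snd) in Hr, Hlft, D0, DM. simpl in *. rewrite cos_neg in DM. lra. }
  split.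
  - exists (2 * sin (t / 2) * sin eta + sin x). split; [nra|].
    rewrite Hr. apply point_ext; simpl; apply (f_equal fst) in DM as DM1; apply (f_equal snd) in DM as DM2;
      simpl in *; rewrite ?sin_neg in *; rewrite ?cos_neg in *; nra.
  - exists (sin x - 2 * sin (t / 2) * sin eta). split; [nra|].
    rewrite Hlft. apply point_ext; simpl; apply (f_equal fst) in DM as DM1; apply (f_equal snd) in DM as DM2;
      simpl in *; rewrite ?sin_neg in *; rewrite ?cos_neg in *; nra.
Qed.

(** With [G = gamma M t] this finds the position of the segment whose two ends carry the support
    lines orthogonal to [dir psi]. *)
Lemma threshold (G : nat -> R) (psi : R) (M : nat) :
  (forall r, G (S r) <= G r) ->
  exists r0, (r0 <= M)%nat /\ (forall r, (r < r0)%nat -> psi <= G r) /\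
    (forall r, (r0 <= r < M)%nat -> G r <= psi).
Proof.
  intros HG. induction M as [|M (r0 & H0 & H1 & H2)].
  - exists 0%nat; repeat split; intros; lia.
  - destruct (Nat.eq_dec r0 M) as [->|Hn].
    + destruct (Rle_lt_dec psi (G M)) as [H|H].
      * exists (S M); split; [lia|]; split; intros r Hr; [|lia].
        destruct (Nat.eq_dec r M) as [->|]; [auto | apply H1; lia].
      * exists M; split; [lia|]; split; auto; intros r Hr.
        replace r with M by lia. lra.
    + exists r0; split; [lia|]; split; auto. intros r Hr.
      destruct (Nat.eq_dec r M) as [->|]; [|apply H2; lia].
      specialize (H2 (M - 1)%nat ltac:(lia)). specialize (HG (M - 1)%nat).
      replace (S (M - 1)) with M in HG by lia. lra.
Qed.

Lemma proj_dir psi x v : proj psi (padd x (dir v)) = proj psi x + cos (v - psi).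
Proof. unfold proj, dir; simpl. rewrite cos_minus. ring. Qed.

Lemma walk_width M t eta f b a psi x y :
  walk M t eta f b a -> - (PI / 2) <= psi <= PI / 2 ->
  (exists r, (r <= M)%nat /\ (b r = x \/ a r = x)) ->
  (exists r, (r <= M)%nat /\ (b r = y \/ a r = y)) ->
  proj psi x - proj psi y <= 1.
Proof.
  intros W Hpsi Hx Hy. pose proof (walk_dual _ _ _ _ _ _ W) as W'.
  pose proof (w_t _ _ _ _ _ _ W) as Ht. pose proof (w_M _ _ _ _ _ _ W) as HM.
  pose proof (pos_INR M) as HM0.
  assert (D : forall r, (r <= M)%nat -> proj psi (b r) = proj psi (a r) + cos (alpha M t r - psi)).
  { intros r Hr. rewrite (w_diam _ _ _ _ _ _ W r Hr). apply proj_dir. }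
  assert (C : forall v, -1 <= cos v <= 1) by apply COS_bound.
  assert (G : forall r, (r < M)%nat -> - PI <= gamma M t r - psi <= PI).
  { intros r Hr. pose proof (gamma_bound _ _ _ _ _ _ r W Hr). split; nra. }
  assert (S : forall s, -1 <= sin s <= 1) by apply SIN_bound.
  destruct (walk_extremes _ _ _ _ _ _ W) as [(xb & Bb & Eb) (xa & Ba & Ea)].
  assert (Pb : proj psi (b 0%nat) = proj psi (b M) + xb * sin psi)
    by (rewrite Eb; unfold proj; simpl; ring).
  assert (Pa : proj psi (a M) = proj psi (a 0%nat) + xa * sin psi)
    by (rewrite Ea; unfold proj; simpl; ring).
  assert (-1 <= xb * sin psi <= 1) by (pose proof (S psi); split; nra).
  assert (-1 <= xa * sin psi <= 1) by (pose proof (S psi); split; nra).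
  pose proof (D 0%nat ltac:(lia)) as D0. pose proof (D M ltac:(lia)) as DM.
  pose proof (C (alpha M t 0 - psi)). pose proof (C (alpha M t M - psi)).
  (* In a direction beyond those of all steps both ends move monotonically, so only the four points
     [b 0], [b M], [a 0], [a M] matter: two pairs are diameters, two are bounded by [walk_extremes].
     Otherwise the position given by [threshold] decides. *)
  destruct (Rlt_le_dec ((INR M / 2 + 1 / 2) * t) psi) as [L1|L1].
  - assert (Dn : forall r, (r < M)%nat -> gamma M t r - psi <= 0).
    { intros r Hr. pose proof (gamma_bound _ _ _ _ _ _ r W Hr). nra. }
    assert (K : forall z, (exists r, (r <= M)%nat /\ (b r = z \/ a r = z)) ->
      (proj psi (b M) <= proj psi z <= proj psi (b 0%nat)) \/
      (proj psi (a 0%nat) <= proj psi z <= proj psi (a M))).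
    { intros z (r & Hr & [<-|<-]); [left | right]; split;
      first [eapply (b_decr_le _ _ _ _ _ _ psi _ _ W) | eapply (a_incr_le _ _ _ _ _ _ psi _ _ W)];
      try lia; intros s Hs; (split; [apply G; lia | apply Dn; lia]). }
    destruct (K x Hx), (K y Hy); lra.
  - destruct (Rlt_le_dec psi (- (INR M / 2 + 1 / 2) * t)) as [L2|L2].
    + assert (Up : forall r, (r < M)%nat -> 0 <= gamma M t r - psi).
      { intros r Hr. pose proof (gamma_bound _ _ _ _ _ _ r W Hr). nra. }
      assert (K : forall z, (exists r, (r <= M)%nat /\ (b r = z \/ a r = z)) ->
        (proj psi (b 0%nat) <= proj psi z <= proj psi (b M)) \/
        (proj psi (a M) <= proj psi z <= proj psi (a 0%nat))).
      { intros z (r & Hr & [<-|<-]); [left | right]; split;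
        first [eapply (b_incr_le _ _ _ _ _ _ psi _ _ W) | eapply (a_decr_le _ _ _ _ _ _ psi _ _ W)];
        try lia; intros s Hs; (split; [apply Up; lia | apply G; lia]). }
      destruct (K x Hx), (K y Hy); lra.
    + destruct (threshold (gamma M t) psi M) as (r0 & Hr0 & Up & Dn).
      { intros r. pose proof (gamma_lt M t r (Datatypes.S r) Ht ltac:(lia)). lra. }
      assert (K : forall z, (exists r, (r <= M)%nat /\ (b r = z \/ a r = z)) ->
        proj psi (a r0) <= proj psi z <= proj psi (b r0)).
      { assert (U : forall r, (r < r0)%nat -> 0 <= gamma M t r - psi <= PI).
        { intros r Hr. specialize (Up r Hr). specialize (G r ltac:(lia)). lra. }
        assert (V : forall r, (r0 <= r < M)%nat -> - PI <= gamma M t r - psi <= 0).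
        { intros r Hr. specialize (Dn r Hr). specialize (G r ltac:(lia)). lra. }
        intros z (r & Hr & Hz).
        pose proof (a_below _ _ _ _ _ _ psi r0 r W Hr0 Hr ltac:(lra) U V) as A1.
        pose proof (a_below _ _ _ _ _ _ psi r0 r W' Hr0 Hr ltac:(lra) U V) as A2.
        cbv beta in A2. rewrite !proj_opp in A2.
        destruct Hz as [<-|<-]; split; try lra; destruct (Nat.le_gt_cases r r0) as [L|L].
        - apply (b_incr_le _ _ _ _ _ _ psi r r0 W); [lia | intros; apply U; lia].
        - apply (b_decr_le _ _ _ _ _ _ psi r0 r W); [lia | intros; apply V; lia].
        - apply (a_decr_le _ _ _ _ _ _ psi r r0 W); [lia | intros; apply U; lia].
        - apply (a_incr_le _ _ _ _ _ _ psi r0 r W); [lia | intros; apply V; lia]. }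
      pose proof (K x Hx). pose proof (K y Hy). pose proof (D r0 Hr0).
      pose proof (C (alpha M t r0 - psi)). lra.
Qed.

(** The distance is the difference of the projections in the direction of [x - y]. Allowing either
    sign of the difference restricts the direction to the upper half-plane, where [asin] recovers
    its angle. *)
Lemma dist_le_1 x y :
  (forall psi, - (PI / 2) <= psi <= PI / 2 ->
     proj psi x - proj psi y <= 1 /\ proj psi y - proj psi x <= 1) ->
  Defs.dist x y <= 1.
Proof.
  intros H. unfold Defs.dist, dist_euc, Rsqr.
  set (dx := fst x - fst y). set (dy := snd x - snd y).
  set (d := sqrt (dx * dx + dy * dy)).
  destruct (Rle_lt_dec d 0) as [Hd|Hd]; [lra|].
  assert (Hdd : d * d = dx * dx + dy * dy) by (apply sqrt_sqrt; nra).
  assert (K : forall s, s * s = 1 -> 0 <= s * dy -> exists psi, - (PI / 2) <= psi <= PI / 2 /\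
             sin psi = s * dx / d /\ cos psi = s * dy / d).
  { intros s Hs Hy. exists (asin (s * dx / d)).
    assert (Hsq : (s * dx / d) * (s * dx / d) + (s * dy / d) * (s * dy / d) = 1).
    { transitivity ((s * s) * (dx * dx + dy * dy) / (d * d)); [field; lra|].
      rewrite Hs, Hdd. field. rewrite <- Hdd. nra. }
    assert (Hc : 0 <= s * dy / d)
      by (apply Rmult_le_pos; [auto | left; now apply Rinv_0_lt_compat]).
    assert (-1 <= s * dx / d <= 1) by (split; nra).
    split; [apply asin_bound | split; [apply sin_asin; auto|]].
    rewrite cos_asin by auto. unfold Rsqr.
    replace (1 - s * dx / d * (s * dx / d)) with (s * dy / d * (s * dy / d)) by lra.
    now apply sqrt_square. }
  assert (E : forall psi s, sin psi = s * dx / d -> cos psi = s * dy / d ->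
            proj psi x - proj psi y = s * d).
  { intros psi s H1 H2. unfold proj. rewrite H1, H2.
    transitivity (s * (dx * dx + dy * dy) / d); [unfold dx, dy; field; lra|].
    rewrite <- Hdd. field; lra. }
  destruct (Rle_lt_dec 0 dy) as [Hy|Hy].
  - destruct (K 1 ltac:(lra) ltac:(lra)) as (psi & Hp & H1 & H2).
    specialize (E psi 1 H1 H2). destruct (H psi Hp). lra.
  - destruct (K (-1) ltac:(lra) ltac:(lra)) as (psi & Hp & H1 & H2).
    specialize (E psi (-1) H1 H2). destruct (H psi Hp). lra.
Qed.

Lemma ngon_small M t eta f b a :
  walk M t eta f b a -> small (M + 2) (ngon M f b a).
Proof.
  intros W. pose proof (ngon_vertices M t eta f b a) as V. split.
  - destruct (proj2 (V (b 0%nat) W)) as (i & Hi & Ei); [exists 0%nat; split; [lia|auto]|].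
    destruct (proj2 (V (a 0%nat) W)) as (j & Hj & Ej); [exists 0%nat; split; [lia|auto]|].
    exists j, i. split; [auto | split; [auto|]]. rewrite Ei, Ej.
    rewrite (w_diam _ _ _ _ _ _ W 0%nat) by lia.
    unfold Defs.dist, dist_euc, padd, dir, Rsqr; simpl. rewrite <- sqrt_1 at 1. f_equal.
    rewrite <- (sq_sin_cos (alpha M t 0)). ring.
  - intros i j Hi Hj. apply dist_le_1. intros psi Hpsi.
    assert (X := proj1 (V _ W) (ex_intro _ i (conj Hi eq_refl))).
    assert (Y := proj1 (V _ W) (ex_intro _ j (conj Hj eq_refl))).
    split; eapply walk_width; eauto.
Qed.

(** * Polygons symmetric about the vertical axis *)

(* The right half of a polygon symmetric about the vertical axis: the unit
   segment from [low j] to [high j] has direction [u j t], and in step [j] it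
   turns about [low j] if [f j] and about [high j] otherwise. *)
Fixpoint low (f : nat -> bool) (t : R) (j : nat) : point :=
  match j with
  | O => (0, 0)
  | S i => if f i then low f t i else padd (low f t i) (padd (u i t) (opp (u (S i) t)))
  end.

Definition high (f : nat -> bool) (t : R) (j : nat) : point := padd (low f t j) (u j t).

Lemma high_false f t j : f j = false -> high f t (S j) = high f t j.
Proof. intros H. unfold high. simpl low. rewrite H. apply point_ext; simpl; ring. Qed.

(** The [2 m] steps are reflected about the gap between steps [m - 1] and [m], but the [2 m + 1]
    positions about position [m], which lies on the axis; hence [m - 1 - r] here and [m - r] in
    [mirror]. *)
Definition mirror_pat (m : nat) (f : nat -> bool) (r : nat) : bool :=
  f (if (r <? m)%nat then (m - 1 - r)%nat else (r - m)%nat).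

Definition mirror (m : nat) (v : nat -> point) (r : nat) : point :=
  if (r <=? m)%nat then v (m - r)%nat else rho (v (r - m)%nat).

(** The signed horizontal extent of a closing side, which joins one end of the last position to the
    mirror image of the other. *)
Definition ends_sum (f : nat -> bool) (t : R) (m : nat) : R := fst (low f t m) + fst (high f t m).

Lemma mirror_ge m v r : rho (v 0%nat) = v 0%nat -> (m <= r)%nat -> mirror m v r = rho (v (r - m)%nat).
Proof.
  intros H Hr. unfold mirror. destruct (Nat.leb_spec r m); auto.
  replace r with m by lia. now rewrite Nat.sub_diag.
Qed.

Lemma mirror_le m v r : (r <= m)%nat -> mirror m v r = v (m - r)%nat.
Proof. intros H. unfold mirror. apply Nat.leb_le in H. now rewrite H. Qed.

Lemma rho_low0 f t : rho (low f t 0) = low f t 0.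
Proof. apply point_ext; simpl; ring. Qed.

Lemma rho_high0 f t : rho (high f t 0) = high f t 0.
Proof. apply point_ext; simpl; rewrite ?Rmult_0_l, ?sin_0; ring. Qed.

Lemma mirror_pat_lt m f r : (r < m)%nat -> mirror_pat m f r = f (m - 1 - r)%nat.
Proof. intros H. unfold mirror_pat. apply Nat.ltb_lt in H. now rewrite H. Qed.

Lemma mirror_pat_ge m f r : (m <= r)%nat -> mirror_pat m f r = f (r - m)%nat.
Proof. intros H. unfold mirror_pat. apply Nat.ltb_ge in H. now rewrite H. Qed.

(** The closing side has length [2 sin (t/2)] and height [cos v >= sin t = 2 sin (t/2) cos (t/2)],
    because [v + t < PI/2]. So its angle [eta] with the vertical satisfies
    [cos eta >= cos (t/2)]. *)
Lemma closing_angle (t v X : R) :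
  0 < t -> 0 <= v -> v + t < PI / 2 ->
  X * X + cos v * cos v = 2 * sin (t / 2) * (2 * sin (t / 2)) ->
  exists eta, - (t / 2) <= eta <= t / 2 /\ 2 * sin (t / 2) * sin eta = X /\
    2 * sin (t / 2) * cos eta = cos v.
Proof.
  intros Ht Hv Hvt HX. pose proof PI_RGT_0.
  assert (Hs : 0 < sin (t / 2)) by (apply sin_gt_0; lra).
  set (s := sin (t / 2)) in *.
  assert (Hc : sin t <= cos v).
  { rewrite <- sin_shift. apply sin_incr_1; lra. }
  assert (Hst : 0 < sin t) by (apply sin_gt_0; lra).
  assert (E : sin t * sin t = 4 * (s * s) * (1 - s * s)).
  { replace t with (2 * (t / 2)) by field. rewrite sin_2a. fold s.
    pose proof (sq_sin_cos (t / 2)) as Q. fold s in Q.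
    transitivity (4 * (s * s) * (cos (t / 2) * cos (t / 2))); [ring | f_equal; lra]. }
  set (x := X / (2 * s)).
  assert (Ex : 2 * s * x = X) by (unfold x; field; lra).
  assert (Hx : x * x <= s * s).
  { apply Rmult_le_reg_l with (4 * (s * s)); [nra|].
    replace (4 * (s * s) * (x * x)) with (X * X) by (rewrite <- Ex; ring).
    assert (sin t * sin t <= cos v * cos v) by (apply Rmult_le_compat; lra). lra. }
  assert (Hs1 : s <= 1) by apply SIN_bound.
  assert (Hxs : - s <= x <= s) by (split; nra).
  exists (asin x).
  pose proof (asin_bound x) as Hb.
  assert (Sx : sin (asin x) = x) by (apply sin_asin; lra).
  split; [split|split].
  - apply sin_incr_0; try lra. rewrite Sx, sin_neg. fold s. lra.
  - apply sin_incr_0; try lra. rewrite Sx. fold s. lra.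
  - now rewrite Sx.
  - rewrite cos_asin by lra. unfold Rsqr.
    assert (Q : (2 * s) * (2 * s) * (1 - x * x) = cos v * cos v).
    { replace (2 * s * (2 * s) * (1 - x * x)) with (2 * s * (2 * s) - (2 * s * x) * (2 * s * x)) by ring.
      rewrite Ex. lra. }
    replace (1 - x * x) with ((cos v / (2 * s)) * (cos v / (2 * s))).
    + rewrite sqrt_square; [field; lra|].
      apply Rmult_le_pos; [lra | left; apply Rinv_0_lt_compat; lra].
    + apply Rmult_eq_reg_l with (2 * s * (2 * s)); [|nra]. rewrite Q. field; lra.
Qed.

Lemma mirror_walk f t m :
  (1 <= m)%nat -> 0 < t -> (INR m + 1) * t < PI / 2 ->
  ends_sum f t m * ends_sum f t m + cos (INR m * t) * cos (INR m * t)
    = 2 * sin (t / 2) * (2 * sin (t / 2)) ->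
  exists eta, walk (2 * m) t eta (mirror_pat m f) (mirror m (high f t)) (mirror m (low f t)).
Proof.
  intros Hm Ht HM HX. pose proof (pos_INR m).
  destruct (closing_angle t (INR m * t) (ends_sum f t m)) as (eta & He & E1 & E2); auto; try nra.
  exists eta.
  assert (H2 : INR (2 * m) / 2 = INR m) by (rewrite mult_INR; simpl; field).
  constructor; rewrite ?H2; auto.
  - intros r Hr. unfold alpha. rewrite H2.
    destruct (Nat.le_gt_cases r m) as [L|L].
    + rewrite !mirror_le by auto. unfold high, u, dir. now rewrite minus_INR.
    + rewrite !mirror_ge by (auto using rho_low0, rho_high0; lia).
      unfold high, u, dir. rewrite minus_INR by lia.
      replace ((INR m - INR r) * t) with (- ((INR r - INR m) * t)) by ring.
      rewrite sin_neg, cos_neg. apply point_ext; simpl; ring.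
  - intros r Hr Hf. destruct (Nat.lt_ge_cases r m) as [L|L].
    + rewrite mirror_pat_lt in Hf by auto. rewrite !mirror_le by lia.
      replace (m - r)%nat with (S (m - 1 - r)) by lia. simpl low at 2. rewrite Hf. f_equal; lia.
    + rewrite mirror_pat_ge in Hf by auto.
      rewrite !mirror_ge by (auto using rho_low0; lia).
      replace (S r - m)%nat with (S (r - m)) by lia. simpl low. now rewrite Hf.
  - intros r Hr Hf. destruct (Nat.lt_ge_cases r m) as [L|L].
    + rewrite mirror_pat_lt in Hf by auto. rewrite !mirror_le by lia.
      replace (m - r)%nat with (S (m - 1 - r)) by lia. rewrite (high_false _ _ _ Hf). f_equal; lia.
    + rewrite mirror_pat_ge in Hf by auto.
      rewrite !mirror_ge by (auto using rho_high0; lia).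
      replace (S r - m)%nat with (S (r - m)) by lia. now rewrite high_false.
  - rewrite mirror_le by lia. rewrite mirror_ge by (auto using rho_low0; lia).
    replace (m - 0)%nat with m by lia. replace (2 * m - m)%nat with m by lia.
    unfold ends_sum in E1. apply point_ext; simpl.
    + simpl in E1. lra.
    + rewrite E2. reflexivity.
  - rewrite mirror_le by lia. rewrite mirror_ge by (auto using rho_high0; lia).
    replace (m - 0)%nat with m by lia. replace (2 * m - m)%nat with m by lia.
    unfold ends_sum in E1. apply point_ext; simpl.
    + simpl in E1. lra.
    + rewrite Ropp_mult_distr_r_reverse, E2. simpl. ring.
Qed.

Lemma mirror_vertices f t m x :
  (exists r, (r <= 2 * m)%nat /\ (mirror m (high f t) r = x \/ mirror m (low f t) r = x)) <->
  (exists j, (j <= m)%nat /\ ((low f t j = x \/ high f t j = x) \/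
                              (rho (low f t j) = x \/ rho (high f t j) = x))).
Proof.
  split.
  - intros (r & Hr & H). destruct (Nat.le_gt_cases r m) as [L|L].
    + rewrite !mirror_le in H by auto. exists (m - r)%nat. split; [lia|]. tauto.
    + rewrite !mirror_ge in H by (auto using rho_low0, rho_high0; lia).
      exists (r - m)%nat. split; [lia|]. tauto.
  - intros (j & Hj & [H|H]).
    + exists (m - j)%nat. split; [lia|]. rewrite !mirror_le by lia.
      replace (m - (m - j))%nat with j by lia. tauto.
    + exists (m + j)%nat. split; [lia|].
      rewrite !mirror_ge by (auto using rho_low0, rho_high0; lia).
      replace (m + j - m)%nat with j by lia. tauto.
Qed.

(** * Mossinghoff's polygon *)

(* The first eight letters of the Thue-Morse word, repeated periodically. *)
Definition pat (j : nat) : bool :=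
  nth (j mod 8) (false :: true :: true :: false :: true :: false :: false :: true :: nil) false.

(* The word of M_n. *)
Definition mpat (j : nat) : bool := if (j <? 2)%nat then negb (pat j) else pat j.

Lemma mpat_ge j : (2 <= j)%nat -> mpat j = pat j.
Proof. intros H. unfold mpat. apply Nat.ltb_ge in H. now rewrite H. Qed.

Lemma pat_mod i j : pat (8 * i + j) = pat j.
Proof.
  unfold pat. f_equal. rewrite Nat.add_comm, Nat.mul_comm. apply Nat.Div0.mod_add.
Qed.

Lemma keep_mod K k j :
  (k <= 2 * K - 1)%nat -> (j = 4 * k + 3 \/ j = 4 * k + 4 \/ j = 4 * k + 5)%nat ->
  negb (removed (16 * K) j) = true.
Proof.
  intros Hk Hj. apply negb_true_iff. unfold removed.
  apply not_true_iff_false. intros E. apply existsb_exists in E as (i & _ & E).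
  apply Nat.eqb_eq in E. lia.
Qed.

(** Each block from [4 k + 3] to [4 k + 6] loses exactly its last element. The number 2 stays, as
    the removed numbers start at 6. *)
Lemma count_indices K k :
  (1 <= K)%nat -> (k <= 2 * K - 1)%nat ->
  length (filter (fun j => negb (removed (16 * K) j)) (seq 1 (4 * k + 2))) = (3 * k + 2)%nat.
Proof.
  intros HK. induction k as [|k IH]; intros Hk.
  - assert (H : forall j, (j <= 2)%nat -> negb (removed (16 * K) j) = true).
    { intros j Hj. apply negb_true_iff, not_true_iff_false. unfold removed. intros E.
      apply existsb_exists in E as (i & Hi & E). apply in_seq in Hi. apply Nat.eqb_eq in E. lia. }
    simpl filter. now rewrite !H by lia.
  - replace (4 * S k + 2)%nat with (4 * k + 2 + 4)%nat by lia.
    rewrite seq_app, filter_app, length_app, IH by lia.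
    assert (E : removed (16 * K) (S (S (S (1 + (4 * k + 2))))) = true).
    { unfold removed. apply existsb_exists. exists (S k).
      replace (16 * K / 8)%nat with (2 * K)%nat
        by (replace (16 * K)%nat with (2 * K * 8)%nat by lia; now rewrite Nat.div_mul).
      split; [apply in_seq; lia | apply Nat.eqb_eq; lia]. }
    cbn [seq filter].
    rewrite E, !(keep_mod K k) by lia. simpl. lia.
Qed.

Lemma nth_indices K k d j :
  (1 <= K)%nat -> (k <= 2 * K - 1)%nat -> (d <= 2)%nat -> j = (4 * k + 3 + d)%nat ->
  (j <= 8 * K - 1)%nat ->
  nth (3 * k + 2 + d) (indices (16 * K)) 0%nat = j.
Proof.
  intros HK Hk Hd -> Hj. unfold indices.
  replace (16 * K / 2 - 1)%nat with (8 * K - 1)%nat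
    by (replace (16 * K)%nat with (8 * K * 2)%nat by lia; now rewrite Nat.div_mul).
  set (keep := fun j => negb (removed (16 * K) j)).
  assert (C : length (filter keep (seq 1 (4 * k + 2 + d))) = (3 * k + 2 + d)%nat).
  { rewrite seq_app, filter_app, length_app. unfold keep at 1. rewrite count_indices by auto.
    assert (d = 0 \/ d = 1 \/ d = 2)%nat as [->|[->| ->]] by lia; cbn [seq filter length];
      unfold keep; rewrite ?(keep_mod K k) by lia; simpl; lia. }
  rewrite <- C at 1.
  replace (4 * k + 2 + d)%nat with (4 * k + 3 + d - 1)%nat by lia.
  apply nth_filter_seq; [lia|]. apply (keep_mod K k); lia.
Qed.

Lemma nth_indices_small K i :
  (1 <= K)%nat -> (i <= 1)%nat -> nth i (indices (16 * K)) 0%nat = S i.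
Proof.
  intros HK Hi. unfold indices.
  replace (16 * K / 2 - 1)%nat with (8 * K - 1)%nat
    by (replace (16 * K)%nat with (8 * K * 2)%nat by lia; now rewrite Nat.div_mul).
  set (keep := fun j => negb (removed (16 * K) j)).
  assert (H : forall j, (j <= 2)%nat -> keep j = true).
  { intros j Hj. apply negb_true_iff, not_true_iff_false. unfold removed. intros E.
    apply existsb_exists in E as (l & Hl & E). apply in_seq in Hl. apply Nat.eqb_eq in E. lia. }
  replace (8 * K - 1)%nat with (S (S (8 * K - 3))) by lia.
  cbn [seq filter]. rewrite !H by lia.
  assert (i = 0 \/ i = 1)%nat as [->| ->] by lia; reflexivity.
Qed.

Lemma p_step K t k d :
  (1 <= K)%nat -> (k <= 2 * K - 1)%nat -> (d <= 2)%nat -> (4 * k + 3 + d <= 8 * K - 1)%nat ->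
  p (16 * K) t (3 * k + 3 + d) =
    padd (p (16 * K) t (3 * k + 2 + d)) (pscale ((-1) ^ (k + d)) (u (4 * k + 3 + d) t)).
Proof.
  intros HK Hk Hd Hj. replace (3 * k + 3 + d)%nat with (S (3 * k + 2 + d)) by lia.
  cbn [p]. rewrite (nth_indices K k d _ HK Hk Hd eq_refl Hj).
  replace (3 * k + 2 + d)%nat with (k + d + 2 * (k + 1))%nat at 2 by lia.
  now rewrite pow_add, pow_1_even, Rmult_1_r.
Qed.

(* Where the spine of M_n is at the diameters of index 4k+2, ..., 4k+5. *)
Definition spine_block (K : nat) (t : R) (k : nat) (a b : nat -> point) : Prop :=
  a (4 * k + 2)%nat = p (16 * K) t (3 * k + 2) /\
  a (4 * k + 3)%nat = p (16 * K) t (3 * k + 2) /\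
  b (4 * k + 3)%nat = p (16 * K) t (3 * k + 3) /\
  ((k < 2 * K - 1)%nat ->
   b (4 * k + 4)%nat = p (16 * K) t (3 * k + 3) /\
   a (4 * k + 4)%nat = p (16 * K) t (3 * k + 4) /\
   a (4 * k + 5)%nat = p (16 * K) t (3 * k + 4) /\
   b (4 * k + 5)%nat = p (16 * K) t (3 * k + 5) /\
   b (4 * k + 6)%nat = p (16 * K) t (3 * k + 5)).

Lemma low_true f t j : f j = true -> low f t (S j) = low f t j.
Proof. intros H. simpl. now rewrite H. Qed.

Lemma pow_m1_even k : Nat.Even k -> (-1) ^ k = 1.
Proof. intros [i ->]. apply pow_1_even. Qed.

Lemma pow_m1_odd k : Nat.Odd k -> (-1) ^ k = -1.
Proof. intros [i ->]. rewrite Nat.add_1_r. apply pow_1_odd. Qed.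

(** The letters at [4 k + 2], ..., [4 k + 5] alternate, so the ends of the segment advance in turn
    and form the zigzag of the [p]. For [k >= 1] the letters at [4 k + 1] and [4 k + 2] agree: one
    end rests for two steps, and the other passes through the pendant vertex [q] in between. For odd
    [k] the two ends exchange roles. *)
Lemma spine_even K t k :
  (1 <= K)%nat -> (k <= 2 * K - 1)%nat -> Nat.Even k ->
  low mpat t (4 * k + 2) = p (16 * K) t (3 * k + 2) ->
  spine_block K t k (low mpat t) (high mpat t).
Proof.
  intros HK Hk He H2. pose proof (pow_m1_even k He) as Pk.
  assert (P1 : (-1) ^ (k + 1) = -1) by (rewrite pow_add, Pk; lra).
  assert (P2 : (-1) ^ (k + 2) = 1) by (rewrite pow_add, Pk; lra).
  assert (T : forall d, pat (4 * k + d) = pat d).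
  { destruct He as [i ->]. intros d. rewrite Nat.mul_assoc. apply pat_mod. }
  assert (S2 : mpat (4 * k + 2) = true) by (rewrite mpat_ge, T by lia; reflexivity).
  assert (S3 : mpat (4 * k + 3) = false) by (rewrite mpat_ge, T by lia; reflexivity).
  assert (S4 : mpat (4 * k + 4) = true) by (rewrite mpat_ge, T by lia; reflexivity).
  assert (S5 : mpat (4 * k + 5) = false) by (rewrite mpat_ge, T by lia; reflexivity).
  pose proof (p_step K t k 0 HK Hk ltac:(lia)) as Q0.
  pose proof (p_step K t k 1 HK Hk ltac:(lia)) as Q1.
  pose proof (p_step K t k 2 HK Hk ltac:(lia)) as Q2.
  rewrite !Nat.add_0_r, Pk in Q0. rewrite P1 in Q1. rewrite P2 in Q2.
  replace (3 * k + 3 + 1)%nat with (3 * k + 4)%nat in Q1 by lia.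
  replace (3 * k + 2 + 1)%nat with (3 * k + 3)%nat in Q1 by lia.
  replace (3 * k + 3 + 2)%nat with (3 * k + 5)%nat in Q2 by lia.
  replace (3 * k + 2 + 2)%nat with (3 * k + 4)%nat in Q2 by lia.
  replace (4 * k + 3 + 1)%nat with (4 * k + 4)%nat in Q1 by lia.
  replace (4 * k + 3 + 2)%nat with (4 * k + 5)%nat in Q2 by lia.
  assert (A3 : low mpat t (4 * k + 3) = p (16 * K) t (3 * k + 2)).
  { replace (4 * k + 3)%nat with (S (4 * k + 2)) by lia. now rewrite low_true. }
  assert (B3 : high mpat t (4 * k + 3) = p (16 * K) t (3 * k + 3)).
  { unfold high. rewrite A3, Q0 by lia. apply point_ext; simpl; ring. }
  split; [auto | split; [auto | split; [auto|]]]. intros Hk'.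
  assert (B4 : high mpat t (4 * k + 4) = p (16 * K) t (3 * k + 3)).
  { replace (4 * k + 4)%nat with (S (4 * k + 3)) by lia. now rewrite high_false. }
  assert (A4 : low mpat t (4 * k + 4) = p (16 * K) t (3 * k + 4)).
  { rewrite Q1 by lia. rewrite <- B4. unfold high. apply point_ext; simpl; ring. }
  assert (A5 : low mpat t (4 * k + 5) = p (16 * K) t (3 * k + 4)).
  { replace (4 * k + 5)%nat with (S (4 * k + 4)) by lia. now rewrite low_true. }
  assert (B5 : high mpat t (4 * k + 5) = p (16 * K) t (3 * k + 5)).
  { unfold high. rewrite A5, Q2 by lia. apply point_ext; simpl; ring. }
  repeat split; auto.
  replace (4 * k + 6)%nat with (S (4 * k + 5)) by lia. now rewrite high_false.
Qed.

Lemma spine_odd K t k :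
  (1 <= K)%nat -> (k <= 2 * K - 1)%nat -> Nat.Odd k ->
  high mpat t (4 * k + 2) = p (16 * K) t (3 * k + 2) ->
  spine_block K t k (high mpat t) (low mpat t).
Proof.
  intros HK Hk He H2. pose proof (pow_m1_odd k He) as Pk.
  assert (P1 : (-1) ^ (k + 1) = 1) by (rewrite pow_add, Pk; lra).
  assert (P2 : (-1) ^ (k + 2) = -1) by (rewrite pow_add, Pk; lra).
  assert (T : forall d, pat (4 * k + d) = pat (4 + d)).
  { destruct He as [i ->]. intros d.
    replace (4 * (2 * i + 1) + d)%nat with (8 * i + (4 + d))%nat by lia. apply pat_mod. }
  assert (S2 : mpat (4 * k + 2) = false) by (rewrite mpat_ge, T by lia; reflexivity).
  assert (S3 : mpat (4 * k + 3) = true) by (rewrite mpat_ge, T by lia; reflexivity).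
  assert (S4 : mpat (4 * k + 4) = false) by (rewrite mpat_ge, T by lia; reflexivity).
  assert (S5 : mpat (4 * k + 5) = true) by (rewrite mpat_ge, T by lia; reflexivity).
  pose proof (p_step K t k 0 HK Hk ltac:(lia)) as Q0.
  pose proof (p_step K t k 1 HK Hk ltac:(lia)) as Q1.
  pose proof (p_step K t k 2 HK Hk ltac:(lia)) as Q2.
  rewrite !Nat.add_0_r, Pk in Q0. rewrite P1 in Q1. rewrite P2 in Q2.
  replace (3 * k + 3 + 1)%nat with (3 * k + 4)%nat in Q1 by lia.
  replace (3 * k + 2 + 1)%nat with (3 * k + 3)%nat in Q1 by lia.
  replace (3 * k + 3 + 2)%nat with (3 * k + 5)%nat in Q2 by lia.
  replace (3 * k + 2 + 2)%nat with (3 * k + 4)%nat in Q2 by lia.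
  replace (4 * k + 3 + 1)%nat with (4 * k + 4)%nat in Q1 by lia.
  replace (4 * k + 3 + 2)%nat with (4 * k + 5)%nat in Q2 by lia.
  assert (A3 : high mpat t (4 * k + 3) = p (16 * K) t (3 * k + 2)).
  { replace (4 * k + 3)%nat with (S (4 * k + 2)) by lia. now rewrite high_false. }
  assert (B3 : low mpat t (4 * k + 3) = p (16 * K) t (3 * k + 3)).
  { rewrite Q0 by lia. rewrite <- A3. unfold high. apply point_ext; simpl; ring. }
  split; [auto | split; [auto | split; [auto|]]]. intros Hk'.
  assert (B4 : low mpat t (4 * k + 4) = p (16 * K) t (3 * k + 3)).
  { replace (4 * k + 4)%nat with (S (4 * k + 3)) by lia. now rewrite low_true. }
  assert (A4 : high mpat t (4 * k + 4) = p (16 * K) t (3 * k + 4)).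
  { unfold high. rewrite B4, Q1 by lia. apply point_ext; simpl; ring. }
  assert (A5 : high mpat t (4 * k + 5) = p (16 * K) t (3 * k + 4)).
  { replace (4 * k + 5)%nat with (S (4 * k + 4)) by lia. now rewrite high_false. }
  assert (B5 : low mpat t (4 * k + 5) = p (16 * K) t (3 * k + 5)).
  { rewrite Q2 by lia. rewrite <- A5. unfold high. apply point_ext; simpl; ring. }
  repeat split; auto.
  replace (4 * k + 6)%nat with (S (4 * k + 5)) by lia. now rewrite low_true.
Qed.

Lemma spine_start K t :
  (1 <= K)%nat ->
  low mpat t 1 = p (16 * K) t 0 /\ high mpat t 1 = p (16 * K) t 1 /\
  high mpat t 2 = p (16 * K) t 1 /\ low mpat t 2 = p (16 * K) t 2.
Proof.
  intros HK. cbn [p]. rewrite !nth_indices_small by lia.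
  assert (A1 : low mpat t 1 = (0, 0)) by reflexivity.
  assert (B1 : high mpat t 1 = padd (0, 0) (pscale ((-1) ^ 0) (u 1 t)))
    by (unfold high; rewrite A1; apply point_ext; simpl; ring).
  assert (B2 : high mpat t 2 = high mpat t 1) by (now rewrite high_false).
  repeat split; auto.
  - now rewrite B2.
  - rewrite <- B1, <- B2. unfold high. apply point_ext; simpl; ring.
Qed.

Lemma spine K t k :
  (1 <= K)%nat -> (k <= 2 * K - 1)%nat ->
  (Nat.Even k /\ spine_block K t k (low mpat t) (high mpat t)) \/
  (Nat.Odd k /\ spine_block K t k (high mpat t) (low mpat t)).
Proof.
  intros HK. induction k as [|k IH]; intros Hk.
  - left. split; [now exists 0%nat|]. apply spine_even; auto; [now exists 0%nat|].
    now apply spine_start.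
  - destruct IH as [[He H]|[He H]]; [lia| |].
    + right. split; [now apply Nat.Odd_succ|]. apply spine_odd; auto; [now apply Nat.Odd_succ|].
      destruct H as (_ & _ & _ & H). destruct H as (_ & _ & _ & _ & H); [lia|].
      replace (4 * S k + 2)%nat with (4 * k + 6)%nat by lia.
      replace (3 * S k + 2)%nat with (3 * k + 5)%nat by lia. exact H.
    + left. split; [now apply Nat.Even_succ|]. apply spine_even; auto; [now apply Nat.Even_succ|].
      destruct H as (_ & _ & _ & H). destruct H as (_ & _ & _ & _ & H); [lia|].
      replace (4 * S k + 2)%nat with (4 * k + 6)%nat by lia.
      replace (3 * S k + 2)%nat with (3 * k + 5)%nat by lia. exact H.
Qed.

(** * Identifying the chosen polygon by its vertices *)

Lemma next_lt n i : (0 < n)%nat -> (next n i < n)%nat.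
Proof. intros; apply Nat.mod_upper_bound; lia. Qed.

Lemma convex_next_neq n P i : convex_ngon n P -> (i < n)%nat -> P (next n i) <> P i.
Proof.
  intros [Hn H] Hi E.
  assert (exists k, (k < n)%nat /\ k <> i /\ k <> next n i) as (k & Hk & H1 & H2).
  { destruct (Nat.eq_dec 0 i), (Nat.eq_dec 0 (next n i)), (Nat.eq_dec 1 i), (Nat.eq_dec 1 (next n i));
      first [exists 0%nat; lia | exists 1%nat; lia | exists 2%nat; lia]. }
  specialize (H i k Hi Hk H1 H2). rewrite E in H. unfold orient in H. lra.
Qed.

Lemma orient_swap x y z : orient x z y = - orient x y z.
Proof. unfold orient; ring. Qed.

(* Makes the perimeter of the polygon chosen by [epsilon] computable. *)
Lemma convex_same_vertices n P Q :
  convex_ngon n P -> convex_ngon n Q ->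
  (forall i, (i < n)%nat -> exists j, (j < n)%nat /\ P i = Q j) ->
  (forall j, (j < n)%nat -> exists i, (i < n)%nat /\ P i = Q j) ->
  forall i, (i < n)%nat ->
    exists j, (j < n)%nat /\ P i = Q j /\ P (next n i) = Q (next n j).
Proof.
  intros CP CQ HPQ HQP i Hi. pose proof (proj1 CP) as Hn.
  destruct (HPQ i Hi) as (a & Ha & Ea).
  destruct (HPQ (next n i) (next_lt n i ltac:(lia))) as (b & Hb & Eb).
  exists a; split; [auto | split; [auto|]].
  destruct (Nat.eq_dec b (next n a)) as [->|Hba]; auto. exfalso.
  pose proof (convex_next_neq n P i CP Hi) as NP.
  pose proof (convex_next_neq n Q a CQ Ha) as NQ.
  (* If the successors differed, each would lie strictly to the left of the side towards the other,
     giving one triangle both orientations. *)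
  assert (O : 0 < orient (Q a) (Q (next n a)) (Q b)).
  { apply CQ; auto. intros ->. congruence. }
  destruct (HQP (next n a) (next_lt n a ltac:(lia))) as (k & Hk & Ek).
  assert (O' : 0 < orient (P i) (P (next n i)) (P k)).
  { apply CP; auto.
    - intros ->. congruence.
    - intros ->. rewrite <- Eb, Ek in O. unfold orient in O. lra. }
  rewrite Ea, Eb, Ek, orient_swap in O'. lra.
Qed.

Lemma perimeter_equilateral n P l :
  (1 <= n)%nat -> (forall i, (i < n)%nat -> side n P i = l) -> perimeter n P = INR n * l.
Proof.
  intros Hn H. unfold perimeter. rewrite (sum_eq _ (fun _ => l)).
  - rewrite sum_cte. replace (S (n - 1)) with n by lia. ring.
  - intros i Hi. apply H. lia.
Qed.

(* Vanishes when the closing sides have length [2 sin (t/2)]. *)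
Definition defect (f : nat -> bool) (m : nat) (t : R) : R :=
  ends_sum f t m * ends_sum f t m + cos (INR m * t) * cos (INR m * t)
    - 2 * sin (t / 2) * (2 * sin (t / 2)).

Lemma three_eighths K : (3 * (16 * K) / 8 = 6 * K)%nat.
Proof. replace (3 * (16 * K))%nat with (6 * K * 8)%nat by lia. now rewrite Nat.div_mul. Qed.

Lemma one_eighth K : (16 * K / 8 = 2 * K)%nat.
Proof. replace (16 * K)%nat with (2 * K * 8)%nat by lia. now rewrite Nat.div_mul. Qed.

Lemma spine_end K t :
  (1 <= K)%nat ->
  high mpat t (8 * K - 1) = p (16 * K) t (6 * K - 1) /\
  low mpat t (8 * K - 1) = p (16 * K) t (6 * K).
Proof.
  intros HK. destruct (spine K t (2 * K - 1) HK (le_n _)) as [[He H]|[He H]].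
  - exfalso. destruct He. lia.
  - destruct H as (_ & H1 & H2 & _).
    replace (4 * (2 * K - 1) + 3)%nat with (8 * K - 1)%nat in * by lia.
    replace (3 * (2 * K - 1) + 2)%nat with (6 * K - 1)%nat in * by lia.
    replace (3 * (2 * K - 1) + 3)%nat with (6 * K)%nat in * by lia. auto.
Qed.

Lemma closing_eq_defect K t :
  (1 <= K)%nat -> 0 < t < PI -> closing_eq (16 * K) t <-> defect mpat (8 * K - 1) t = 0.
Proof.
  intros HK Ht. unfold closing_eq. rewrite three_eighths.
  destruct (spine_end K t HK) as [<- <-].
  assert (Hs : 0 < sin (t / 2)) by (apply sin_gt_0; lra).
  unfold Defs.dist, dist_euc, defect, ends_sum.
  set (m := (8 * K - 1)%nat).
  set (S := Rsqr _ + Rsqr _).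
  assert (E : S = (fst (low mpat t m) + fst (high mpat t m)) *
                  (fst (low mpat t m) + fst (high mpat t m)) + cos (INR m * t) * cos (INR m * t))
    by (unfold S, Rsqr, high; simpl; ring).
  assert (0 <= S) by (apply Rplus_le_le_0_compat; apply Rle_0_sqr).
  rewrite <- E. split; intros H1.
  - rewrite <- H1, sqrt_sqrt by auto. ring.
  - apply Rminus_diag_uniq in H1. rewrite H1. apply sqrt_square. lra.
Qed.

Lemma q_eq K t k :
  (1 <= K)%nat -> (1 <= k <= 2 * K - 1)%nat ->
  (low mpat t (4 * k + 2) = p (16 * K) t (3 * k + 2) /\ high mpat t (4 * k + 2) = q (16 * K) t k) \/
  (high mpat t (4 * k + 2) = p (16 * K) t (3 * k + 2) /\ low mpat t (4 * k + 2) = q (16 * K) t k).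
Proof.
  intros HK Hk. destruct (spine K t k HK ltac:(lia)) as [[He (H & _)]|[He (H & _)]].
  - left. split; [auto|]. unfold q. rewrite <- H, (pow_m1_even k He).
    unfold high. apply point_ext; simpl; ring.
  - right. split; [auto|]. unfold q. rewrite <- H, (pow_m1_odd k He).
    unfold high. apply point_ext; simpl; ring.
Qed.

Definition on_spine (K : nat) (t : R) (x : point) : Prop :=
  x = (0, 0) \/ x = (0, 1) \/
  (exists i, (1 <= i <= 6 * K)%nat /\ x = p (16 * K) t i) \/
  (exists k, (1 <= k <= 2 * K - 1)%nat /\ x = q (16 * K) t k).

Lemma half_vertices K t x :
  (1 <= K)%nat ->
  (exists j, (j <= 8 * K - 1)%nat /\ (low mpat t j = x \/ high mpat t j = x)) <-> on_spine K t x.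
Proof.
  intros HK. destruct (spine_start K t HK) as (A1 & B1 & B2 & A2).
  split.
  - intros (j & Hj & H).
    assert (P : forall i, (1 <= i <= 6 * K)%nat -> on_spine K t (p (16 * K) t i)).
    { intros i Hi. right; right; left. eauto. }
    assert (Q : forall k, (1 <= k <= 2 * K - 1)%nat -> on_spine K t (q (16 * K) t k)).
    { intros k Hk. right; right; right. eauto. }
    destruct (Nat.le_gt_cases j 1) as [L|L].
    + assert (j = 0 \/ j = 1)%nat as [->| ->] by lia.
      * destruct H as [<-|<-]; [now left | right; left].
        unfold high; apply point_ext; simpl; rewrite Rmult_0_l, ?sin_0, ?cos_0; ring.
      * destruct H as [<-|<-]; [now left|]. rewrite B1. apply P; lia.
    + set (k := ((j - 2) / 4)%nat). set (d := ((j - 2) mod 4)%nat).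
      assert (Ej : (j = 4 * k + 2 + d)%nat).
      { pose proof (Nat.div_mod_eq (j - 2) 4). unfold k, d. lia. }
      assert (Hd : (d < 4)%nat) by (apply Nat.mod_upper_bound; lia).
      clearbody k d. subst j.
      assert (d = 0 \/ d = 1 \/ d = 2 \/ d = 3)%nat as [->|[->|[->| ->]]] by lia;
        rewrite <- ?Nat.add_assoc in H; simpl (2 + _)%nat in H.
      (* There is no [q] for [k = 0]: at position 2 the other end is still [p] number 1. *)
      * destruct (Nat.eq_dec k 0) as [->|Hk].
        -- simpl Nat.mul in H; simpl Nat.add in H.
           rewrite A2, B2 in H. destruct H as [<-|<-]; apply P; lia.
        -- destruct (q_eq K t k HK ltac:(lia)) as [[E1 E2]|[E1 E2]];
             rewrite E1, E2 in H; destruct H as [<-|<-]; try (apply P; lia); apply Q; lia.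
      * destruct (spine K t k HK ltac:(lia)) as [[He (_ & E1 & E2 & _)]|[He (_ & E1 & E2 & _)]];
          rewrite E1, E2 in H; destruct H as [<-|<-]; apply P; lia.
      * destruct (spine K t k HK ltac:(lia)) as [[He (_ & _ & _ & E)]|[He (_ & _ & _ & E)]];
          destruct E as (E1 & E2 & _); try lia;
          rewrite E1, E2 in H; destruct H as [<-|<-]; apply P; lia.
      * destruct (spine K t k HK ltac:(lia)) as [[He (_ & _ & _ & E)]|[He (_ & _ & _ & E)]];
          destruct E as (_ & _ & E1 & E2 & _); try lia;
          rewrite E1, E2 in H; destruct H as [<-|<-]; apply P; lia.
  - intros [->|[->|[(i & Hi & ->)|(k & Hk & ->)]]].
    + exists 0%nat. split; [lia | now left].
    + exists 0%nat. split; [lia | right].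
      unfold high; apply point_ext; simpl; rewrite Rmult_0_l, ?sin_0, ?cos_0; ring.
    + destruct (Nat.eq_dec i 1) as [->|Hi1]; [exists 1%nat; split; [lia | now right]|].
      set (k := ((i - 2) / 3)%nat). set (d := ((i - 2) mod 3)%nat).
      assert (Ei : (i = 3 * k + 2 + d)%nat).
      { pose proof (Nat.div_mod_eq (i - 2) 3). unfold k, d. lia. }
      assert (Hd : (d < 3)%nat) by (apply Nat.mod_upper_bound; lia).
      clearbody k d. subst i.
      assert (d = 0 \/ d = 1 \/ d = 2)%nat as [->|[->| ->]] by lia;
        rewrite <- ?Nat.add_assoc; simpl (2 + _)%nat.
      * exists (4 * k + 2)%nat. split; [lia|].
        destruct (spine K t k HK ltac:(lia)) as [[_ (E & _)]|[_ (E & _)]]; auto.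
      * exists (4 * k + 3)%nat. split; [lia|].
        destruct (spine K t k HK ltac:(lia)) as [[_ (_ & _ & E & _)]|[_ (_ & _ & E & _)]]; auto.
      * exists (4 * k + 4)%nat. split; [lia|].
        destruct (spine K t k HK ltac:(lia)) as [[_ (_ & _ & _ & E)]|[_ (_ & _ & _ & E)]];
          destruct E as (_ & E & _); auto; lia.
    + exists (4 * k + 2)%nat. split; [lia|].
      destruct (q_eq K t k HK Hk) as [[_ E]|[_ E]]; auto.
Qed.

Lemma rho_rho x : rho (rho x) = x.
Proof. apply point_ext; simpl; ring. Qed.

Lemma rho_axis y : rho (0, y) = (0, y).
Proof. apply point_ext; simpl; ring. Qed.

Lemma on_spine_mossinghoff K t x :
  mossinghoff_vertex (16 * K) t x <-> on_spine K t x \/ on_spine K t (rho x).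
Proof.
  unfold mossinghoff_vertex, on_spine. rewrite three_eighths, one_eighth. split.
  - intros [H|[H|[(i & Hi & [H|H])|(k & Hk & [H|H])]]].
    + left; auto.
    + left; auto.
    + left; right; right; left; eauto.
    + right; right; right; left. exists i; split; auto. rewrite H; apply rho_rho.
    + left; right; right; right; eauto.
    + right; right; right; right. exists k; split; auto. rewrite H; apply rho_rho.
  - intros [[H|[H|[(i & Hi & H)|(k & Hk & H)]]]|[H|[H|[(i & Hi & H)|(k & Hk & H)]]]].
    + auto.
    + auto.
    + right; right; left; eauto.
    + right; right; right; eauto.
    + left. rewrite <- (rho_rho x), H. apply rho_axis.
    + right; left. rewrite <- (rho_rho x), H. apply rho_axis.
    + right; right; left. exists i; split; auto. right. now rewrite <- H, rho_rho.
    + right; right; right. exists k; split; auto. right. now rewrite <- H, rho_rho.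
Qed.

Definition sym_ngon (m : nat) (f : nat -> bool) (t : R) : polygon :=
  ngon (2 * m) (mirror_pat m f) (mirror m (high f t)) (mirror m (low f t)).

Lemma INR_16 K : INR (16 * K) = 16 * INR K.
Proof. rewrite mult_INR. simpl. ring. Qed.

Lemma INR_8 K : (1 <= K)%nat -> INR (8 * K - 1) = 8 * INR K - 1.
Proof. intros H. rewrite minus_INR, mult_INR by lia. simpl. ring. Qed.

Lemma sym_walk K f t :
  (1 <= K)%nat -> 0 < t < PI / INR (16 * K) -> defect f (8 * K - 1) t = 0 ->
  exists eta, walk (2 * (8 * K - 1)) t eta (mirror_pat (8 * K - 1) f)
    (mirror (8 * K - 1) (high f t)) (mirror (8 * K - 1) (low f t)).
Proof.
  intros HK Ht Hd. apply mirror_walk; [lia | lra | |].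
  - rewrite INR_8 by auto. rewrite INR_16 in Ht. apply le_INR in HK; simpl in HK.
    destruct Ht as [_ Ht]. apply (Rmult_lt_compat_r (8 * INR K)) in Ht; [|lra].
    replace (PI / (16 * INR K) * (8 * INR K)) with (PI / 2) in Ht by (field; lra). lra.
  - unfold defect in Hd. lra.
Qed.

Lemma angle_lt_PI K t : (1 <= K)%nat -> 0 < t < PI / INR (16 * K) -> 0 < t < PI.
Proof.
  intros HK Ht. split; [lra|]. apply Rlt_trans with (1 := proj2 Ht). rewrite INR_16.
  apply le_INR in HK; simpl in HK. pose proof PI_RGT_0.
  apply Rmult_lt_reg_r with (16 * INR K); [lra|].
  unfold Rdiv. rewrite Rmult_assoc, Rinv_l by lra. nra.
Qed.

Lemma is_mossinghoff_sym K t :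
  (1 <= K)%nat -> largest_solution (16 * K) t ->
  is_mossinghoff (16 * K) (sym_ngon (8 * K - 1) mpat t).
Proof.
  intros HK HL. exists t. split; [auto|]. destruct HL as (Ht & Hc & _).
  pose proof (angle_lt_PI K t HK Ht) as HtPI.
  apply closing_eq_defect in Hc; auto.
  destruct (sym_walk K mpat t HK Ht Hc) as [eta W].
  assert (En : (16 * K = 2 * (8 * K - 1) + 2)%nat) by lia. split.
  - rewrite En. eapply ngon_convex; eauto; lia.
  - intros x. rewrite on_spine_mossinghoff, <- !half_vertices by auto.
    rewrite En. unfold sym_ngon. rewrite (ngon_vertices _ _ _ _ _ _ x W), mirror_vertices. split.
    + intros (j & Hj & [H|[H|H]]); [left | right | right]; exists j; split; auto;
        rewrite <- H, rho_rho; auto.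
    + intros [(j & Hj & H)|(j & Hj & H)]; exists j; split; auto.
      right. destruct H as [H|H]; rewrite H, rho_rho; auto.
Qed.

Lemma perimeter_sym K f t :
  (1 <= K)%nat -> 0 < t < PI / INR (16 * K) -> defect f (8 * K - 1) t = 0 ->
  (forall i, (i < 16 * K)%nat -> side (16 * K) (sym_ngon (8 * K - 1) f t) i = 2 * sin (t / 2)).
Proof.
  intros HK Ht Hd i Hi. destruct (sym_walk K f t HK Ht Hd) as [eta W].
  replace (16 * K)%nat with (2 * (8 * K - 1) + 2)%nat in * by lia.
  eapply ngon_side; eauto.
Qed.

Lemma largest_solution_unique n t t' : largest_solution n t -> largest_solution n t' -> t = t'.
Proof.
  intros (H1 & H2 & H3) (H1' & H2' & H3'). apply Rle_antisym; auto.
Qed.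

(** The choice operator yields some convex polygon for some largest solution. That solution is
    unique, so the vertex set, and by convexity the set of sides, is that of the symmetric
    polygon. *)
Lemma perimeter_mossinghoff K t :
  (1 <= K)%nat -> largest_solution (16 * K) t ->
  perimeter (16 * K) (mossinghoff (16 * K)) = INR (16 * K) * (2 * sin (t / 2)).
Proof.
  intros HK HL. pose proof (is_mossinghoff_sym K t HK HL) as HM.
  destruct (epsilon_spec (inhabits (fun _ : nat => (0, 0))) (is_mossinghoff (16 * K))
              (ex_intro _ _ HM)) as (t' & HL' & C' & V').
  fold (mossinghoff (16 * K)) in C', V'.
  rewrite <- (largest_solution_unique _ _ _ HL HL') in V'.
  destruct HM as (t1 & HL1 & C & V).
  rewrite <- (largest_solution_unique _ _ _ HL HL1) in V.
  apply perimeter_equilateral; [lia|]. intros i Hi.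
  destruct (convex_same_vertices _ _ _ C' C) with (i := i) as (j & Hj & E1 & E2); auto.
  - intros k Hk. destruct (proj2 (V (mossinghoff (16 * K) k))) as (j & Hj & E); eauto.
    apply V'. eauto.
  - intros k Hk. destruct (proj2 (V' (sym_ngon (8 * K - 1) mpat t k))) as (j & Hj & E); eauto.
    apply V. eauto.
  - unfold side. rewrite E1, E2. destruct HL as (Ht & Hc & _).
    apply (perimeter_sym K mpat t); auto.
    apply closing_eq_defect; auto. now apply (angle_lt_PI K).
Qed.

(** * The closing equation *)

Definition rise (t : R) (j : nat) : R := sin (INR (S j) * t) - sin (INR j * t).

Lemma ends_sum_S f t j :
  ends_sum f t (S j) = ends_sum f t j + (if f j then rise t j else - rise t j).
Proof.
  unfold ends_sum, high, rise. simpl low. destruct (f j); simpl fst; simpl; ring.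
Qed.

Lemma ends_sum_0 f t : ends_sum f t 0 = 0.
Proof. unfold ends_sum; simpl. rewrite Rmult_0_l, sin_0. ring. Qed.

(** With [E] the shift of the argument by [t], the eight signs form [-(1 - E)(1 - E^2)(1 - E^4)],
    and a rise is [E - 1] applied to the sine; the block is [(1 - E)^2 (1 - E^2)(1 - E^4)] applied
    to it. Since [1 - E^8 = (1 - E^4)(1 + E^4)], and [1 + E^4] acts on sines as [2 cos (2 t)] times
    the shift by [2 t], the product with [cos (2 t)] is a difference over one period. The three
    remaining factors give [2 (1 - cos t) sin t]. *)
Lemma pat_block x t :
  let r i := sin (x + (INR i + 1) * t) - sin (x + INR i * t) in
  cos (2 * t) * (- r 0%nat + r 1%nat + r 2%nat - r 3%nat + r 4%nat - r 5%nat - r 6%nat + r 7%nat)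
  = 2 * (1 - cos t) * sin t * (cos x - cos (x + 8 * t)).
Proof.
  intros r. unfold r. clear r. simpl INR.
  (* Around the centre of the block the terms pair up symmetrically, and [sin y] factors out. *)
  set (y := x + 4 * t).
  assert (E : forall k, sin (y - k * t) + sin (y + k * t) = 2 * sin y * cos (k * t)).
  { intros k. rewrite sin_minus, sin_plus. ring. }
  assert (C : cos x - cos (x + 8 * t) = 2 * sin y * sin (4 * t)).
  { replace (x + 8 * t) with (y + 4 * t) by (unfold y; ring).
    replace x with (y - 4 * t) by (unfold y; ring).
    rewrite cos_minus, cos_plus. ring. }
  rewrite C.
  pose proof (E 4) as E4. pose proof (E 3) as E3. pose proof (E 1) as E1.
  replace (x + (0 + 1) * t) with (y - 3 * t) by (unfold y; ring).
  replace (x + 0 * t) with (y - 4 * t) by (unfold y; ring).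
  replace (x + (1 + 1) * t) with (y - 2 * t) by (unfold y; ring).
  replace (x + 1 * t) with (y - 3 * t) by (unfold y; ring).
  replace (x + (1 + 1 + 1) * t) with (y - 1 * t) by (unfold y; ring).
  replace (x + (1 + 1 + 1 + 1) * t) with y by (unfold y; ring).
  replace (x + (1 + 1 + 1 + 1 + 1) * t) with (y + 1 * t) by (unfold y; ring).
  replace (x + (1 + 1 + 1 + 1 + 1 + 1) * t) with (y + 2 * t) by (unfold y; ring).
  replace (x + (1 + 1 + 1 + 1 + 1 + 1 + 1) * t) with (y + 3 * t) by (unfold y; ring).
  replace (x + (1 + 1 + 1 + 1 + 1 + 1 + 1 + 1) * t) with (y + 4 * t) by (unfold y; ring).
  match goal with |- cos (2 * t) * ?L = _ =>
    replace L with (2 * sin y * (cos (4 * t) - 2 * cos (3 * t) + 2 * cos (1 * t) - 1)) by lra end.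
  replace (4 * t) with (2 * (2 * t)) by ring.
  replace (3 * t) with (2 * t + t) by ring. rewrite Rmult_1_l.
  rewrite (sin_2a (2 * t)), (cos_2a_sin (2 * t)), cos_plus, sin_2a, cos_2a.
  pose proof (sq_sin_cos t) as Q.
  set (s := sin t) in *. set (c := cos t) in *. set (z := sin y).
  clearbody s c z.
  assert (Hs : s * s = 1 - c * c) by lra.
  transitivity (2 * z * (c * c - s * s) *
    ((1 - 8 * (s * s) * (c * c)) - 2 * ((c * c - s * s) * c - 2 * (s * s) * c) + 2 * c - 1)); [ring|].
  transitivity (2 * (1 - c) * (2 * z) * (2 * (2 * (s * s) * c) * (c * c - s * s))); [|ring].
  rewrite Hs. ring.
Qed.

Lemma pat_sum K t :
  cos (2 * t) * ends_sum pat t (8 * K) = 2 * (1 - cos t) * sin t * (1 - cos (8 * INR K * t)).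
Proof.
  induction K as [|K IH].
  - rewrite ends_sum_0. simpl INR. rewrite !Rmult_0_r, Rmult_0_l, cos_0. ring.
  - replace (8 * S K)%nat with (S (S (S (S (S (S (S (S (8 * K)))))))))%nat by lia.
    rewrite !ends_sum_S.
    assert (P : forall i, pat (8 * K + i) = pat i) by apply pat_mod.
    pose proof (P 0%nat) as P0. pose proof (P 1%nat) as P1. pose proof (P 2%nat) as P2.
    pose proof (P 3%nat) as P3. pose proof (P 4%nat) as P4. pose proof (P 5%nat) as P5.
    pose proof (P 6%nat) as P6. pose proof (P 7%nat) as P7.
    rewrite Nat.add_0_r in P0.
    rewrite !Nat.add_succ_r, Nat.add_0_r in *.
    rewrite P0, P1, P2, P3, P4, P5, P6, P7.
    cbn [pat nth Nat.modulo Nat.divmod fst snd Nat.sub].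
    pose proof (pat_block (8 * INR K * t) t) as B. cbv beta zeta in B.
    assert (R : forall i, rise t (8 * K + i) =
              sin (8 * INR K * t + (INR i + 1) * t) - sin (8 * INR K * t + INR i * t)).
    { intros i. unfold rise. rewrite S_INR, plus_INR, mult_INR.
      replace (INR 8) with 8 by (simpl; ring). f_equal; apply f_equal; ring. }
    rewrite <- !R in B. rewrite !Nat.add_succ_r, Nat.add_0_r in B.
    rewrite (S_INR K). replace (8 * (INR K + 1) * t) with (8 * INR K * t + 8 * t) by ring.
    change (pat 0) with false; change (pat 1) with true; change (pat 2) with true;
    change (pat 3) with false; change (pat 4) with true; change (pat 5) with false;
    change (pat 6) with false; change (pat 7) with true; cbv iota.
    lra.
Qed.

(** Flipping the first two letters adds twice the first rise minus the second,
    [2 (2 sin t - sin (2 t))]. This is the origin of [kappa = 2]. *)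
Lemma mpat_sum t j :
  (2 <= j)%nat -> ends_sum mpat t j = ends_sum pat t j + 4 * (1 - cos t) * sin t.
Proof.
  intros H. induction H as [|j H IH].
  - rewrite !ends_sum_S, !ends_sum_0. unfold rise.
    change (mpat 0) with true; change (mpat 1) with false; change (pat 0) with false;
      change (pat 1) with true; cbv iota.
    simpl INR. replace ((1 + 1) * t) with (2 * t) by ring. rewrite sin_2a, Rmult_0_l, sin_0, Rmult_1_l.
    ring.
  - rewrite !ends_sum_S, IH, mpat_ge by auto. destruct (pat j); ring.
Qed.

Lemma pat_last K : (1 <= K)%nat -> pat (8 * K - 1) = true.
Proof.
  intros H. replace (8 * K - 1)%nat with (8 * (K - 1) + 7)%nat by lia. apply pat_mod.
Qed.

(** Half of the polygon has [8 * K - 1] steps, one short of [K] full periods, so the last step is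
    subtracted from the telescoped sum. *)
Lemma ends_sum_last f K t beta :
  (1 <= K)%nat -> f (8 * K - 1)%nat = true -> beta = PI / 2 - 8 * INR K * t ->
  ends_sum f t (8 * K - 1) = ends_sum f t (8 * K) - (cos beta - cos (beta + t)) /\
  cos (INR (8 * K - 1) * t) = sin (beta + t).
Proof.
  intros HK Hf Hb. rewrite INR_8 by auto.
  replace (8 * K)%nat with (S (8 * K - 1)) at 2 by lia.
  rewrite ends_sum_S, Hf. unfold rise.
  replace (INR (S (8 * K - 1))) with (8 * INR K) by (rewrite S_INR, INR_8 by auto; ring).
  rewrite INR_8 by auto.
  replace (8 * INR K * t) with (PI / 2 - beta) by lra.
  replace ((8 * INR K - 1) * t) with (PI / 2 - (beta + t)) by lra.
  rewrite !sin_shift, cos_shift. split; ring.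
Qed.

(** All terms without [Y] carry a factor [sin beta]: for [Y = 0] the polygon closes at
    [beta = 0]. *)
Lemma defect_form f K t beta :
  (1 <= K)%nat -> f (8 * K - 1)%nat = true -> beta = PI / 2 - 8 * INR K * t ->
  let Y := ends_sum f t (8 * K) in
  defect f (8 * K - 1) t =
    Y * Y - 2 * Y * (cos beta - cos (beta + t))
    + sin beta * sin beta * (2 * cos t - 1) + 2 * sin beta * cos beta * sin t.
Proof.
  intros HK Hf Hb Y. destruct (ends_sum_last f K t beta HK Hf Hb) as [E1 E2].
  unfold defect. rewrite E1, E2. fold Y.
  assert (S : 2 * sin (t / 2) * (2 * sin (t / 2)) = 2 - 2 * cos t).
  { replace (cos t) with (cos (2 * (t / 2))) by (f_equal; field). rewrite cos_2a_sin. ring. }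
  rewrite S, cos_plus, sin_plus.
  pose proof (sq_sin_cos t) as Qt. pose proof (sq_sin_cos beta) as Qb.
  set (s := sin t) in *. set (c := cos t) in *. set (sb := sin beta) in *. set (cb := cos beta) in *.
  clearbody s c sb cb Y.
  assert (Hs : s * s = 1 - c * c) by lra.
  assert (Hb' : cb * cb = 1 - sb * sb) by lra.
  match goal with |- ?L = ?R => assert (L - R = 0); [|lra] end.
  match goal with |- ?L = 0 => transitivity
    (cb * cb * (1 - 2 * c + c * c + s * s) + sb * sb * (s * s + c * c - 2 * c + 1) - 2 + 2 * c) end.
  - ring.
  - rewrite Hs, Hb'. ring.
Qed.

(** Three terms of the Leibniz series. For [n >= 16] the angle is then at most [52 / 240], whence
    the bound [22 / 100] in the estimates below. *)
Lemma PI_upper : PI <= 52 / 15.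
Proof.
  destruct (PI_ineq 1) as [_ H]. unfold tg_alt, PI_tg in H. simpl in H. lra.
Qed.

(** * Continuity and sign changes *)

Lemma continuity_ends_sum f m : continuity (fun t => ends_sum f t m).
Proof.
  induction m as [|m IH].
  - replace (fun t => ends_sum f t 0) with (fun _ : R => 0)
      by (apply functional_extensionality; intros; now rewrite ends_sum_0).
    apply continuity_const. intros x y; reflexivity.
  - replace (fun t => ends_sum f t (S m)) with
      (fun t => ends_sum f t m + (if f m then 1 else -1) * (sin (INR (S m) * t) - sin (INR m * t)))
      by (apply functional_extensionality; intros; rewrite ends_sum_S; unfold rise;
          destruct (f m); ring).
    apply (continuity_plus (fun t => ends_sum f t m)); [auto|].
    assert (C : forall k, continuity (fun t => sin (k * t))).
    { intros k. apply (continuity_comp (fun t => k * t) sin); [|apply continuity_sin].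
      apply (continuity_scal id k). apply derivable_continuous, derivable_id. }
    apply (continuity_scal (fun t => sin (INR (S m) * t) - sin (INR m * t))).
    apply (continuity_minus (fun t => sin (INR (S m) * t)) (fun t => sin (INR m * t))); apply C.
Qed.

Lemma continuity_defect f m : continuity (defect f m).
Proof.
  unfold defect.
  apply (continuity_minus (fun t => ends_sum f t m * ends_sum f t m + cos (INR m * t) * cos (INR m * t))
           (fun t => 2 * sin (t / 2) * (2 * sin (t / 2)))).
  - apply (continuity_plus (fun t => ends_sum f t m * ends_sum f t m)).
    + apply (continuity_mult (fun t => ends_sum f t m)); apply continuity_ends_sum.
    + assert (C : continuity (fun t => cos (INR m * t))).
      { apply (continuity_comp (fun t => INR m * t) cos); [|apply continuity_cos].
        apply (continuity_scal id). apply derivable_continuous, derivable_id. }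
      apply (continuity_mult (fun t => cos (INR m * t))); auto.
  - assert (C : continuity (fun t => 2 * sin (t / 2))).
    { apply (continuity_scal (fun t => sin (t / 2))).
      apply (continuity_comp (fun t => t / 2) sin); [|apply continuity_sin].
      apply (continuity_div id (fun _ => 2)).
      - apply derivable_continuous, derivable_id.
      - apply continuity_const. intros x y; reflexivity.
      - intros; lra. }
    apply (continuity_mult (fun t => 2 * sin (t / 2))); auto.
Qed.

Lemma zero_between F a b :
  continuity F -> a < b -> 0 < F a -> F b < 0 -> exists z, a < z < b /\ F z = 0.
Proof.
  intros HF Hab Ha Hb.
  destruct (IVT (fun x => - F x) a b) as (z & Hz & E); try lra.
  - now apply continuity_opp.
  - exists z. assert (z <> a) by (intros ->; lra). assert (z <> b) by (intros ->; lra).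
    split; lra.
Qed.

Lemma largest_zero F a b :
  continuity F -> a < b -> 0 < F a -> F b < 0 ->
  exists z, a < z < b /\ F z = 0 /\ forall z', a < z' < b -> F z' = 0 -> z' <= z.
Proof.
  intros HF Hab Ha Hb.
  destruct (zero_between F a b HF Hab Ha Hb) as (z0 & Hz0 & E0).
  destruct (completeness (fun x => a < x < b /\ F x = 0)) as (z & Hub & Hlub).
  - exists b. intros x [Hx _]. lra.
  - exists z0. auto.
  - assert (Hz1 : z0 <= z) by (apply Hub; auto).
    assert (Hz2 : z <= b) by (apply Hlub; intros x [Hx _]; lra).
    assert (Ez : F z = 0).
    { destruct (Req_dec (F z) 0) as [E|N]; auto. exfalso.
      (* If [F z] were nonzero, [F] would not vanish within [d] of [z], and [z - d / 2] would be a
         smaller upper bound of the zeros. *)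
      destruct (HF z (Rabs (F z)) (Rabs_pos_lt _ N)) as (d & Hd & Hcont).
      assert (Hub' : is_upper_bound (fun x => a < x < b /\ F x = 0) (z - d / 2)).
      { intros x [Hx Ex]. apply Rnot_lt_le. intros Hlt.
        assert (x <= z) by (apply Hub; auto).
        destruct (Req_dec x z) as [->|Nx]; [auto|].
        specialize (Hcont x). simpl in Hcont. unfold D_x, no_cond, R_dist in Hcont.
        rewrite Ex in Hcont.
        assert (Rabs (0 - F z) < Rabs (F z)).
        { apply Hcont. split; [split; auto|]. apply Rabs_def1; lra. }
        rewrite Rminus_0_l, Rabs_Ropp in H0. lra. }
      specialize (Hlub _ Hub'). lra. }
    exists z. split; [|split; auto; intros; apply Hub; auto].
    assert (z <> b) by (intros ->; lra). lra.
Qed.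

(** * Estimates of the closing expression *)

Lemma sin_taylor x : 0 <= x <= 1 -> x - x * x * x / 6 <= sin x <= x.
Proof.
  intros Hx. pose proof PI2_3_2. split.
  - destruct (pre_sin_bound x 0) as [H1 _]; [lra | lra |].
    unfold sin_approx, sin_term in H1. simpl in H1. lra.
  - destruct (Req_dec x 0) as [->|N]; [rewrite sin_0; lra|]. left. apply sin_lt_x. lra.
Qed.

Lemma cos_taylor x :
  0 <= x <= 1 -> 1 - x * x / 2 <= cos x <= 1 - x * x / 2 + x * x * x * x / 24.
Proof.
  intros Hx. replace (cos x) with (1 - 2 * sin (x / 2) * sin (x / 2))
    by (rewrite <- cos_2a_sin; f_equal; field).
  destruct (sin_taylor (x / 2)) as [H1 H2]; [lra|].
  set (s := sin (x / 2)) in *. clearbody s.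
  assert (0 <= x * x) by nra. assert (x * x <= 1) by nra.
  assert (0 <= x / 2 - x / 2 * (x / 2) * (x / 2) / 6) by nra.
  split; [nra|].
  assert (x / 2 * (x / 2 - x / 2 * (x / 2) * (x / 2) / 3) <= s * s); [|nra].
  nra.
Qed.

(* Closed form of [ends_sum] after [n / 2] steps, one beyond the last position:
   [kappa] is 0 for [pat] and 2 for [mpat].  It is [(1 + kappa) t^3 + O(t^4)]. *)
Definition surplus (kappa t beta : R) : R :=
  2 * (1 - cos t) * sin t * ((1 - sin beta) / cos (2 * t) + kappa).

(* [defect] in terms of [Y = surplus kappa t beta] and [beta = PI / 2 - n t / 2]. *)
Definition closing (Y t beta : R) : R :=
  Y * Y - 2 * Y * (cos beta - cos (beta + t))
  + sin beta * sin beta * (2 * cos t - 1) + 2 * sin beta * cos beta * sin t.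


(** The first two bounds serve the sign arguments: they keep [Y], and the sum of the two values of
    [Y] that are compared, below twice the chord. The last two give
    [Y = (1 + kappa) t^3 + O(t^4)]. *)
Lemma surplus_bounds kappa t beta :
  0 <= kappa <= 2 -> 0 < t <= 22 / 100 -> 0 <= beta <= t ->
  0 < surplus kappa t beta /\ surplus 0 t beta + surplus 2 t beta < 2 * (1 - cos t) /\
  surplus kappa t beta <= t * t * t * (1 + kappa + 4 * (t * t)) /\
  t * t * t * (1 + kappa - 2 * t) <= surplus kappa t beta.
Proof.
  intros Hk Ht Hb.
  destruct (sin_taylor t) as [s1 s2]; [lra|].
  destruct (cos_taylor t) as [c1 c2]; [lra|].
  destruct (sin_taylor beta) as [b1 b2]; [lra|].
  destruct (cos_taylor (2 * t)) as [d1 d2]; [lra|].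
  assert (d3 : cos (2 * t) <= 1) by apply COS_bound.
  unfold surplus. set (s := sin t) in *. set (w := 1 - cos t).
  assert (w1 : t * t / 2 - t * t * t * t / 24 <= w) by (unfold w; lra).
  assert (w2 : w <= t * t / 2) by (unfold w; lra).
  clearbody s w. set (sb := sin beta) in *. clearbody sb.
  set (c := cos (2 * t)) in *. clearbody c. clear c1 c2 d2.
  assert (T2 : 0 < t * t) by nra. assert (T2' : t * t <= 5 / 100) by nra.
  assert (Hc : 9 / 10 <= c) by nra.
  assert (Hw : 0 < w) by nra.
  assert (Hs : 0 < s) by nra.
  assert (Hsb : 0 <= sb) by nra.
  assert (Hi : 0 < / c) by (apply Rinv_0_lt_compat; lra).
  assert (Ei : c * / c = 1) by (apply Rinv_r; lra).
  assert (I1 : 1 <= / c) by nra.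
  assert (I2 : / c <= 1 + 4 * (t * t)).
  { apply Rmult_le_reg_l with c; [lra|]. rewrite Ei. nra. }
  assert (I3 : / c <= 12 / 10) by lra.
  unfold Rdiv. set (i := / c) in *. clearbody i.
  assert (E1 : 1 - beta <= (1 - sb) * i) by nra.
  assert (E2 : (1 - sb) * i <= 1 + 4 * (t * t)) by nra.
  set (e := (1 - sb) * i) in *. clearbody e.
  assert (Hws : 0 < w * s) by nra.
  assert (WS : w * s <= t * t * t / 2) by nra.
  assert (WL : t * t * t / 2 * (1 - t * t / 4) <= w * s).
  { apply Rle_trans with ((t * t / 2 - t * t * t * t / 24) * (t - t * t * t / 6)).
    - assert (0 <= t * t * t * (t * t) * (t * t)) by (repeat apply Rmult_le_pos; lra). nra.
    - apply Rmult_le_compat; nra. }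
  split; [nra|]. split.
  { assert (s * (2 * e + 2) < 1) by nra. nra. }
  split.
  - replace (2 * w * s * (e + kappa)) with (2 * (w * s) * (e + kappa)) by ring.
    apply Rle_trans with (t * t * t * (e + kappa)).
    + apply Rmult_le_compat_r; lra.
    + apply Rmult_le_compat_l; [|lra]. repeat apply Rmult_le_pos; lra.
  - replace (2 * w * s * (e + kappa)) with (2 * (w * s) * (e + kappa)) by ring.
    apply Rle_trans with (2 * (t * t * t / 2 * (1 - t * t / 4)) * (e + kappa)).
    + assert (0 <= t * t * t) by (repeat apply Rmult_le_pos; lra).
      assert (1 + kappa - 2 * t <= (1 - t * t / 4) * (e + kappa)) by nra. nra.
    + apply Rmult_le_compat_r; lra.
Qed.

Lemma chord_bounds t beta :
  0 < t <= 22 / 100 -> 0 <= beta <= t ->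
  1 - cos t <= cos beta - cos (beta + t) /\
  cos beta - cos (beta + t) <= t * t / 2 + beta * t /\
  t * t / 2 - t * t * t * t <= cos beta - cos (beta + t).
Proof.
  intros Ht Hb.
  destruct (sin_taylor t) as [s1 s2]; [lra|].
  destruct (cos_taylor t) as [c1 c2]; [lra|].
  destruct (sin_taylor beta) as [b1 b2]; [lra|].
  destruct (cos_taylor beta) as [d1 d2]; [lra|].
  assert (d3 : cos beta <= 1) by apply COS_bound.
  pose proof (sq_sin_cos beta) as Q. rewrite cos_plus.
  set (s := sin t) in *. set (c := cos t) in *.
  set (sb := sin beta) in *. set (cb := cos beta) in *. clearbody s c sb cb.
  assert (Hs : 0 <= s) by nra. assert (Hsb : 0 <= sb) by nra. assert (Hcb : 0 <= cb) by nra.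
  assert (W : 1 - c <= s) by nra.
  assert (W0 : 0 <= 1 - c) by nra.
  assert (P : 1 - cb <= sb) by nra.
  assert (B2 : beta * beta <= t * t) by nra.
  assert (SS : sb * s <= beta * t) by nra.
  split; [nra|]. split.
  - nra.
  - assert (t * t / 2 - t * t * t * t <= cb * (1 - c)); [|nra].
    apply Rle_trans with ((1 - t * t / 2) * (t * t / 2 - t * t * t * t / 24)).
    + assert (0 <= t * t * t * t) by (repeat apply Rmult_le_pos; lra).
      assert (0 <= t * t * t * t * t * t) by (repeat apply Rmult_le_pos; lra). nra.
    + apply Rmult_le_compat; nra.
Qed.

(** At [beta = 0] the expression is [Y (Y - 2 (1 - cos t))], and [0 < Y < 2 (1 - cos t)]. *)
Lemma closing_neg kappa t :
  0 <= kappa <= 2 -> 0 < t <= 22 / 100 -> closing (surplus kappa t 0) t 0 < 0.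
Proof.
  intros Hk Ht. destruct (surplus_bounds kappa t 0 Hk Ht ltac:(lra)) as (H1 & H2 & _).
  destruct (surplus_bounds 0 t 0 ltac:(lra) Ht ltac:(lra)) as (H3 & _).
  assert (H4 : surplus kappa t 0 <= surplus 2 t 0).
  { unfold surplus. apply Rmult_le_compat_l; [|lra].
    apply Rmult_le_pos; [|apply sin_ge_0; pose proof PI2_3_2; lra].
    destruct (COS_bound t); lra. }
  unfold closing. rewrite sin_0, cos_0, Rplus_0_l. nra.
Qed.

(** In terms of [w = 1 - cos t] the positive part without [Y] is of order [w], whereas the negative
    term is at most [12 w^2] because [Y < 2 w]. *)
Lemma closing_pos kappa t :
  0 <= kappa <= 2 -> 0 < t <= 22 / 100 -> 0 < closing (surplus kappa t t) t t.
Proof.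
  intros Hk Ht. destruct (surplus_bounds kappa t t Hk Ht ltac:(lra)) as (H1 & H2 & _).
  destruct (surplus_bounds 0 t t ltac:(lra) Ht ltac:(lra)) as (H3 & _).
  assert (H4 : surplus kappa t t <= surplus 2 t t).
  { unfold surplus. apply Rmult_le_compat_l; [|lra].
    apply Rmult_le_pos; [|apply sin_ge_0; pose proof PI2_3_2; lra].
    destruct (COS_bound t); lra. }
  unfold closing. replace (t + t) with (2 * t) by ring. rewrite cos_2a_cos.
  destruct (cos_taylor t) as [c1 c2]; [lra|].
  pose proof (sq_sin_cos t) as Q. set (Y := surplus kappa t t) in *.
  assert (HY : Y < 2 * (1 - cos t)) by lra. clearbody Y.
  set (c := cos t) in *. set (s := sin t) in *. clearbody c s.
  replace (Y * Y - 2 * Y * (c - (2 * c * c - 1)) + s * s * (2 * c - 1) + 2 * s * c * s)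
    with (Y * Y - 2 * Y * ((1 - c) * (1 + 2 * c)) + (s * s) * (4 * c - 1)) by ring.
  replace (s * s) with ((1 - c) * (1 + c)) by lra.
  assert (Hc : 97 / 100 <= c) by nra.
  assert (Hw : 0 < 1 - c) by lra.
  assert (2 * Y * ((1 - c) * (1 + 2 * c)) <= 2 * (2 * (1 - c)) * ((1 - c) * 3)).
  { apply Rmult_le_compat; nra. }
  nra.
Qed.

(* The factor [Y_A - Y_M] of the difference of the two closing expressions is
   negative, and so is the other one, [Y_A + Y_M - 2 (cos beta - cos (beta + t))]. *)
Lemma closing_compare t beta :
  0 < t <= 22 / 100 -> 0 <= beta <= t ->
  closing (surplus 2 t beta) t beta = 0 -> 0 < closing (surplus 0 t beta) t beta.
Proof.
  intros Ht Hb E.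
  destruct (surplus_bounds 0 t beta ltac:(lra) Ht Hb) as (H1 & H2 & _).
  destruct (chord_bounds t beta Ht Hb) as (H3 & _).
  assert (H4 : surplus 0 t beta < surplus 2 t beta).
  { unfold surplus. destruct (cos_taylor t) as [c1 c2]; [lra|].
    destruct (sin_taylor t) as [s1 s2]; [lra|].
    assert (0 < 1 - cos t) by nra. assert (0 < sin t) by nra.
    apply Rmult_lt_compat_l; [|lra]. nra. }
  unfold closing in *. nra.
Qed.

(** With the chord [V = cos beta - cos (beta + t)], the equation balances [2 beta t] against
    [2 Y V - Y^2]. A crude bound on [beta] comes from [V <= 3/2 t^2]; put back into
    [V <= t^2 / 2 + beta t], it gives [V] and then [beta] with the sharp leading term. *)
Lemma closing_expansion kappa t beta :
  0 <= kappa <= 2 -> 0 < t <= 22 / 100 -> 0 <= beta <= t ->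
  closing (surplus kappa t beta) t beta = 0 ->
  beta <= 7 * (t * t * t * t) /\
  Rabs (2 * beta - (1 + kappa) * (t * t * t * t)) <= 100 * (t * t * t * t * t).
Proof.
  intros Hk Ht Hb E.
  destruct (surplus_bounds kappa t beta Hk Ht Hb) as (Y0 & _ & Y2 & Y1).
  destruct (chord_bounds t beta Ht Hb) as (_ & V2 & V1).
  destruct (sin_taylor t) as [s1 s2]; [lra|].
  destruct (cos_taylor t) as [c1 _]; [lra|].
  destruct (sin_taylor beta) as [b1 b2]; [lra|].
  destruct (cos_taylor beta) as [d1 _]; [lra|].
  assert (d2 : cos beta <= 1) by apply COS_bound.
  assert (c2 : cos t <= 1) by apply COS_bound.
  unfold closing in E.
  set (Y := surplus kappa t beta) in *. set (V := cos beta - cos (beta + t)) in *.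
  set (s := sin t) in *. set (c := cos t) in *. set (sb := sin beta) in *. set (cb := cos beta) in *.
  clearbody Y V s c sb cb.
  assert (T2 : t * t <= 5 / 100) by nra. assert (T20 : 0 < t * t) by nra.
  assert (BB : beta * beta <= t * t) by nra.
  assert (sb0 : 0 <= sb) by nra.
  assert (s0 : 0 <= s) by nra.
  assert (SC : beta * (1 - t * t * (2 / 3)) <= sb * cb).
  { apply Rle_trans with (beta * (1 - t * t / 6) * (1 - t * t / 2)); [nra|].
    apply Rmult_le_compat; nra. }
  assert (SCS : beta * t * (1 - t * t) <= sb * cb * s).
  { apply Rle_trans with (beta * (1 - t * t * (2 / 3)) * (t * (1 - t * t / 6))).
    - assert (0 <= beta * t * (t * t)) by (repeat apply Rmult_le_pos; lra).
      assert (0 <= beta * t * (t * t) * (t * t)) by (repeat apply Rmult_le_pos; lra). nra.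
    - apply Rmult_le_compat; nra. }
  assert (GU : 2 * sb * cb * s + sb * sb * (2 * c - 1) <= 2 * beta * t + beta * beta).
  { assert (sb * cb * s <= beta * t) by (rewrite Rmult_assoc; apply Rmult_le_compat; nra).
    assert (sb * sb * (2 * c - 1) <= beta * beta) by nra. nra. }
  assert (GL : 2 * beta * t * (1 - t * t) <= 2 * Y * V - Y * Y).
  { assert (0 <= sb * sb * (2 * c - 1)) by (apply Rmult_le_pos; nra). nra. }
  assert (HV0 : 0 <= V) by nra.
  set (t3 := t * t * t) in *. assert (T3 : 0 < t3) by (unfold t3; nra).
  (* Here [1 + kappa + 4 t^2 <= 4], and [V <= 3/2 t^2] follows from [beta <= t]. So
     [beta (1 - t^2) <= 6 t^4], and [6 / (1 - t^2) <= 7]. *)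
  assert (Yc : Y <= 4 * t3) by nra.
  assert (YV1 : Y * V <= 4 * t3 * (3 / 2 * (t * t))) by (apply Rmult_le_compat; nra).
  assert (B6 : beta <= 7 * (t3 * t)).
  { assert (beta * (1 - t * t) * t <= 6 * (t3 * t) * t) by nra.
    assert (beta * (1 - t * t) <= 6 * (t3 * t)) by (apply Rmult_le_reg_r with t; lra). nra. }
  split; [exact B6|].
  (* All error monomials are compared with [t3 * t3 = t^6], so that linear arithmetic finishes both
     bounds; the constant 100 leaves ample room. *)
  assert (T6 : 0 < t3 * t3) by (apply Rmult_lt_0_compat; auto).
  assert (T7 : 0 <= t3 * t3 * t <= t3 * t3 * (22 / 100))
    by (split; [apply Rmult_le_pos | apply Rmult_le_compat_l]; lra).
  assert (T8 : 0 <= t3 * t3 * (t * t) <= t3 * t3 * (5 / 100))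
    by (split; [apply Rmult_le_pos | apply Rmult_le_compat_l]; lra).
  assert (T10 : t3 * t3 * (t * t) * (t * t) <= t3 * t3 * (t * t) * (5 / 100))
    by (apply Rmult_le_compat_l; lra).
  assert (K7 : 0 <= kappa * (t3 * t3 * t) <= 2 * (t3 * t3 * t))
    by (split; [apply Rmult_le_pos | apply Rmult_le_compat_r]; lra).
  assert (K8 : 0 <= kappa * (t3 * t3 * (t * t)) <= 2 * (t3 * t3 * (t * t)))
    by (split; [apply Rmult_le_pos | apply Rmult_le_compat_r]; lra).
  assert (YY : 0 <= Y * Y) by (apply Rmult_le_pos; lra).
  assert (Up : 2 * beta * t <= (1 + kappa) * (t3 * (t * t)) + 100 * (t3 * t3)).
  { assert (V <= t * t / 2 + 7 * (t3 * t) * t).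
    { apply Rle_trans with (1 := V2). apply Rplus_le_compat_l, Rmult_le_compat_r; lra. }
    assert (Y * V <= t3 * (1 + kappa + 4 * (t * t)) * (t * t / 2 + 7 * (t3 * t) * t))
      by (apply Rmult_le_compat; lra).
    assert (beta * (t * (t * t)) <= 7 * (t3 * t) * (t * (t * t))).
    { apply Rmult_le_compat_r; [|lra]. apply Rmult_le_pos; lra. }
    assert (7 * (t3 * t) * (t * (t * t)) = 7 * (t3 * t3 * t)) by (unfold t3; ring).
    assert (X : 2 * (t3 * (1 + kappa + 4 * (t * t)) * (t * t / 2 + 7 * (t3 * t) * t)) =
      (1 + kappa) * (t3 * (t * t)) + 14 * (t3 * t3 * (t * t)) + 14 * (kappa * (t3 * t3 * (t * t)))
      + 4 * (t3 * t3 * t) + 56 * (t3 * t3 * (t * t) * (t * t))) by (unfold t3; field).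
    lra. }
  assert (Lo : (1 + kappa) * (t3 * (t * t)) - 100 * (t3 * t3) <= 2 * beta * t).
  { assert (t * t * (t * t) <= t * t * (5 / 100)) by (apply Rmult_le_compat_l; lra).
    assert (t3 * (1 + kappa - 2 * t) * (t * t / 2 - t3 * t) <= Y * V).
    { apply Rmult_le_compat; try lra; [apply Rmult_le_pos; lra | unfold t3; lra]. }
    assert (Y * Y <= 4 * t3 * (4 * t3)) by (apply Rmult_le_compat; lra).
    assert (beta * beta <= 7 * (t3 * t) * (7 * (t3 * t))) by (apply Rmult_le_compat; lra).
    assert (X : 2 * (t3 * (1 + kappa - 2 * t) * (t * t / 2 - t3 * t)) =
      (1 + kappa) * (t3 * (t * t)) - 2 * (t3 * t3 * t) - 2 * (kappa * (t3 * t3 * t)) - 2 * (t3 * t3)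
      + 4 * (t3 * t3 * (t * t)) + 2 * (kappa * 0)) by (unfold t3; field).
    assert (7 * (t3 * t) * (7 * (t3 * t)) = 49 * (t3 * t3 * (t * t))) by ring.
    lra. }
  apply Rabs_le. replace (t * t * t * t) with (t3 * t) by reflexivity.
  replace (t3 * t * t) with (t3 * (t * t)) by ring.
  assert (t3 * t3 = t3 * (t * t) * t) by (unfold t3; ring).
  split; apply Rmult_le_reg_r with t; lra.
Qed.

(** * The solutions near PI / n *)

(** With [n = 16 * K], the equation [beta = t] means [(n + 2) t = PI], and [beta = 0] means
    [n t = PI]. *)
Lemma angle_range K t :
  (1 <= K)%nat -> PI / (16 * INR K + 2) <= t <= PI / (16 * INR K) ->
  0 < t <= 22 / 100 /\ 0 <= PI / 2 - 8 * INR K * t <= t.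
Proof.
  intros HK [H1 H2]. apply le_INR in HK; simpl in HK.
  pose proof PI_upper. pose proof PI_RGT_0.
  apply (Rmult_le_compat_r (16 * INR K + 2)) in H1; [|lra].
  apply (Rmult_le_compat_r (16 * INR K)) in H2; [|lra].
  unfold Rdiv in H1, H2. rewrite Rmult_assoc, Rinv_l, Rmult_1_r in H1, H2 by lra.
  split; [|lra]. split; nra.
Qed.

Lemma cos_2t_neq0 t : 0 < t <= 22 / 100 -> cos (2 * t) <> 0.
Proof.
  intros Ht. destruct (cos_taylor (2 * t)) as [H _]; [lra|]. nra.
Qed.

Lemma ends_sum_pat_surplus K t beta :
  0 < t <= 22 / 100 -> beta = PI / 2 - 8 * INR K * t -> ends_sum pat t (8 * K) = surplus 0 t beta.
Proof.
  intros Ht ->. pose proof (cos_2t_neq0 t Ht) as Hc. pose proof (pat_sum K t) as P.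
  unfold surplus. rewrite sin_shift.
  apply Rmult_eq_reg_l with (cos (2 * t)); auto. rewrite P. field; auto.
Qed.

Lemma ends_sum_mpat_surplus K t beta :
  (1 <= K)%nat -> 0 < t <= 22 / 100 -> beta = PI / 2 - 8 * INR K * t ->
  ends_sum mpat t (8 * K) = surplus 2 t beta.
Proof.
  intros HK Ht Hb. rewrite mpat_sum, (ends_sum_pat_surplus K t beta Ht Hb) by lia.
  unfold surplus. ring.
Qed.

Lemma defect_pat K t beta :
  (1 <= K)%nat -> 0 < t <= 22 / 100 -> beta = PI / 2 - 8 * INR K * t ->
  defect pat (8 * K - 1) t = closing (surplus 0 t beta) t beta.
Proof.
  intros HK Ht Hb. rewrite (defect_form pat K t beta HK (pat_last K HK) Hb).
  rewrite (ends_sum_pat_surplus K t beta Ht Hb). reflexivity.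
Qed.

Lemma defect_mpat K t beta :
  (1 <= K)%nat -> 0 < t <= 22 / 100 -> beta = PI / 2 - 8 * INR K * t ->
  defect mpat (8 * K - 1) t = closing (surplus 2 t beta) t beta.
Proof.
  intros HK Ht Hb.
  assert (L : mpat (8 * K - 1) = true) by (rewrite mpat_ge by lia; now apply pat_last).
  rewrite (defect_form mpat K t beta HK L Hb).
  rewrite (ends_sum_mpat_surplus K t beta HK Ht Hb). reflexivity.
Qed.

(** [tm] is the largest zero inside the window and exceeds every solution at or below its lower end.
    The angle of A_n is any zero in the sign change between [tm] and [PI / n]. *)
Lemma solutions K :
  (1 <= K)%nat -> exists ta tm,
    PI / (16 * INR K + 2) < tm < ta /\ ta < PI / (16 * INR K) /\
    defect pat (8 * K - 1) ta = 0 /\ defect mpat (8 * K - 1) tm = 0 /\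
    largest_solution (16 * K) tm.
Proof.
  intros HK. pose proof (le_INR _ _ HK) as HK'; simpl in HK'.
  pose proof PI_upper as PU. pose proof PI_RGT_0 as P0.
  set (t1 := PI / (16 * INR K + 2)). set (t0 := PI / (16 * INR K)).
  assert (H10 : t1 < t0).
  { unfold t1, t0, Rdiv. apply Rmult_lt_compat_l; [lra|]. apply Rinv_lt_contravar; nra. }
  destruct (angle_range K t0 HK ltac:(unfold t1, t0 in *; lra)) as [B0 C0].
  destruct (angle_range K t1 HK ltac:(unfold t1, t0 in *; lra)) as [B1 C1].
  assert (E0 : 0 = PI / 2 - 8 * INR K * t0) by (unfold t0; field; lra).
  assert (E1 : t1 = PI / 2 - 8 * INR K * t1) by (unfold t1; field; lra).
  destruct (largest_zero (defect mpat (8 * K - 1)) t1 t0) as (tm & Hm & Zm & Lm); auto.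
  { apply continuity_defect. }
  { rewrite (defect_mpat K t1 t1 HK B1 E1). apply closing_pos; lra. }
  { rewrite (defect_mpat K t0 0 HK B0 E0). apply closing_neg; lra. }
  destruct (angle_range K tm HK ltac:(unfold t1, t0 in *; lra)) as [Bm Cm].
  destruct (zero_between (defect pat (8 * K - 1)) tm t0) as (ta & Ha & Za).
  { apply continuity_defect. }
  { lra. }
  { rewrite (defect_pat K tm _ HK Bm eq_refl). apply closing_compare; auto.
    now rewrite <- (defect_mpat K tm _ HK Bm eq_refl). }
  { rewrite (defect_pat K t0 0 HK B0 E0). apply closing_neg; lra. }
  assert (Hpi : t0 < PI) by (pose proof PI2_3_2; lra).
  exists ta, tm. repeat split; try lra.
  - rewrite INR_16. fold t0. lra.
  - apply closing_eq_defect; auto. lra.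
  - rewrite INR_16. fold t0. intros t' Ht' Hc.
    apply closing_eq_defect in Hc; auto; [|lra].
    destruct (Rle_lt_dec t' t1); [lra|]. apply Lm; auto. lra.
Qed.

(** * Perimeters *)

(** By the mean value theorem the shortfall is exactly [2 beta cos c] with [c] between [t / 2] and
    [PI / (2 n)]. The constant 105 covers 100 from [closing_expansion], 2 for replacing [cos c] by
    1, and 1 for replacing [t^4] by [(PI / n)^4]. *)
Lemma perimeter_expansion K kappa t f :
  (1 <= K)%nat -> 0 <= kappa <= 2 ->
  PI / (16 * INR K + 2) < t < PI / (16 * INR K) ->
  (forall beta, 0 < t <= 22 / 100 -> beta = PI / 2 - 8 * INR K * t ->
     defect f (8 * K - 1) t = closing (surplus kappa t beta) t beta) ->
  defect f (8 * K - 1) t = 0 ->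
  Rabs (Lbar (16 * K) - INR (16 * K) * (2 * sin (t / 2))
        - (1 + kappa) * PI ^ 4 / INR (16 * K) ^ 4) <= 105 * PI ^ 5 * (1 / INR (16 * K) ^ 5).
Proof.
  intros HK Hk Ht Hf Hd. pose proof PI_RGT_0 as P0. pose proof PI2_3_2 as P32.
  destruct (angle_range K t HK ltac:(lra)) as [Bt Bb].
  set (beta := PI / 2 - 8 * INR K * t) in *.
  rewrite (Hf beta Bt eq_refl) in Hd.
  destruct (closing_expansion kappa t beta Hk Bt Bb Hd) as [B7 BX].
  unfold Lbar. rewrite INR_16.
  pose proof (le_INR _ _ HK) as HK'; simpl in HK'.
  destruct (angle_range K (PI / (16 * INR K)) HK) as [B0 _].
  { split; [|lra]. lra. }
  set (N := 16 * INR K) in *. set (t0 := PI / N) in *.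
  assert (HN : 16 <= N) by (unfold N; lra).
  replace (PI / (2 * N)) with (t0 / 2) by (unfold t0; field; lra).
  replace ((1 + kappa) * PI ^ 4 / N ^ 4) with ((1 + kappa) * (t0 * t0 * t0 * t0))
    by (unfold t0; field; lra).
  replace (105 * PI ^ 5 * (1 / N ^ 5)) with (105 * (t0 * t0 * t0 * t0 * t0))
    by (unfold t0; field; lra).
  assert (Edt : t0 - t = 2 * beta / N) by (unfold beta, t0, N; field; lra).
  destruct (MVT_cor2 sin cos (t / 2) (t0 / 2)) as (c & Ec & Hc); [lra | |].
  { intros; apply derivable_pt_lim_sin. }
  replace (t0 / 2 - t / 2) with (beta / N) in Ec by lra.
  replace (2 * N * sin (t0 / 2) - N * (2 * sin (t / 2))) with (2 * beta * cos c).
  2:{ transitivity (2 * N * (sin (t0 / 2) - sin (t / 2))); [|ring]. rewrite Ec. field. lra. }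
  assert (Cc : 1 - t0 * t0 / 2 <= cos c <= 1).
  { destruct (cos_taylor c) as [H _]; [lra|]. split; [nra | apply COS_bound]. }
  (* The difference is [2 beta / N], and [2 <= PI]. *)
  assert (Edt' : t0 - t <= beta * t0).
  { rewrite Edt. unfold t0. apply Rmult_le_reg_r with N; [lra|].
    replace (2 * beta / N * N) with (beta * 2) by (field; lra).
    replace (beta * (PI / N) * N) with (beta * PI) by (field; lra).
    apply Rmult_le_compat_l; lra. }
  clear Edt Ec Hc Hf Hd.
  assert (Hlt : t < t0) by lra. clearbody t0 beta N.
  assert (Q2 : t * t <= t0 * t0) by nra.
  assert (Q20 : 0 < t * t) by nra.
  assert (Q4 : t * t * t * t <= t0 * t0 * t0 * t0).
  { replace (t * t * t * t) with (t * t * (t * t)) by ring.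
    replace (t0 * t0 * t0 * t0) with (t0 * t0 * (t0 * t0)) by ring. apply Rmult_le_compat; lra. }
  set (T4 := t0 * t0 * t0 * t0) in *.
  assert (HT4 : 0 < T4) by (unfold T4; repeat apply Rmult_lt_0_compat; lra).
  assert (Q5 : t * t * t * t * t <= T4 * t0).
  { apply Rmult_le_compat; lra. }
  assert (Hbt : beta <= 7 * T4) by lra.
  assert (D1 : 0 <= 2 * beta - 2 * beta * cos c <= 2 * (T4 * t0)).
  { split; [nra|].
    apply Rle_trans with (beta * (t0 * t0)); [nra|].
    apply Rle_trans with (7 * T4 * (t0 * (22 / 100))).
    - apply Rmult_le_compat; nra.
    - nra. }
  assert (D2 : 0 <= T4 - t * t * t * t <= T4 * t0 / 3).
  { split; [lra|].
    replace (T4 - t * t * t * t) with ((t0 - t) * ((t0 + t) * (t0 * t0 + t * t))) by (unfold T4; ring).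
    assert ((t0 + t) * (t0 * t0 + t * t) <= 44 / 100 * (1 / 10)) by (apply Rmult_le_compat; nra).
    apply Rle_trans with (7 * T4 * t0 * (44 / 100 * (1 / 10))).
    - apply Rmult_le_compat; nra.
    - nra. }
  assert (D3 : 0 <= (1 + kappa) * (T4 - t * t * t * t) <= T4 * t0).
  { split; [apply Rmult_le_pos; lra|].
    apply Rle_trans with (3 * (T4 * t0 / 3)); [apply Rmult_le_compat; lra | lra]. }
  assert (BX2 : - (100 * (t * t * t * t * t)) <= 2 * beta - (1 + kappa) * (t * t * t * t)
                <= 100 * (t * t * t * t * t)).
  { pose proof (Rle_abs (2 * beta - (1 + kappa) * (t * t * t * t))).
    pose proof (Rle_abs (- (2 * beta - (1 + kappa) * (t * t * t * t)))).
    rewrite Rabs_Ropp in H0. lra. }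
  apply Rabs_le. lra.
Qed.

Lemma pow2_16 s : (4 <= s)%nat -> (2 ^ s = 16 * 2 ^ (s - 4))%nat /\ (1 <= 2 ^ (s - 4))%nat.
Proof.
  intros H. split.
  - replace s with (4 + (s - 4))%nat at 1 by lia. now rewrite Nat.pow_add_r.
  - pose proof (Nat.pow_nonzero 2 (s - 4)). lia.
Qed.

(** Keeping the angle [tm] of M_n inside the predicate lets one choice provide both the expansion
    and the comparison with M_n. *)
Definition is_better (K : nat) (t : R) : Prop :=
  exists tm, PI / (16 * INR K + 2) < tm < t /\ t < PI / (16 * INR K) /\
    defect pat (8 * K - 1) t = 0 /\ defect mpat (8 * K - 1) tm = 0 /\
    largest_solution (16 * K) tm.

Definition better_angle (K : nat) : R := epsilon (inhabits 0) (is_better K).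

Definition better (n : nat) : polygon :=
  sym_ngon (8 * (n / 16) - 1) pat (better_angle (n / 16)).

Lemma better_angleP K : (1 <= K)%nat -> is_better K (better_angle K).
Proof.
  intros HK. unfold better_angle. apply epsilon_spec. destruct (solutions K HK) as (ta & tm & H).
  exists ta, tm. exact H.
Qed.

Lemma better_16 K : better (16 * K) = sym_ngon (8 * K - 1) pat (better_angle K).
Proof.
  unfold better. replace (16 * K / 16)%nat with K; [reflexivity|].
  rewrite (Nat.mul_comm 16 K), Nat.div_mul by lia. reflexivity.
Qed.

Lemma better_perimeter K :
  (1 <= K)%nat ->
  perimeter (16 * K) (better (16 * K)) = INR (16 * K) * (2 * sin (better_angle K / 2)).
Proof.
  intros HK. destruct (better_angleP K HK) as (tm & H1 & H2 & H3 & _).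
  rewrite better_16. apply perimeter_equilateral; [lia|].
  apply perimeter_sym; auto. rewrite INR_16. pose proof PI_RGT_0.
  pose proof (le_INR _ _ HK) as HK'; simpl in HK'.
  assert (0 < PI / (16 * INR K + 2)) by (apply Rdiv_lt_0_compat; lra). lra.
Qed.

Lemma better_gap K :
  (1 <= K)%nat ->
  Rabs (Lbar (16 * K) - perimeter (16 * K) (better (16 * K)) - PI ^ 4 / INR (16 * K) ^ 4)
    <= 105 * PI ^ 5 * (1 / INR (16 * K) ^ 5).
Proof.
  intros HK. rewrite better_perimeter by auto.
  destruct (better_angleP K HK) as (tm & H1 & H2 & H3 & _).
  replace (PI ^ 4 / INR (16 * K) ^ 4) with ((1 + 0) * PI ^ 4 / INR (16 * K) ^ 4)
    by (rewrite Rplus_0_r, Rmult_1_l; reflexivity).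
  apply (perimeter_expansion K 0 (better_angle K) pat); auto; try lra.
  intros; apply defect_pat; auto.
Qed.

Lemma mossinghoff_gap K :
  (1 <= K)%nat ->
  Rabs (Lbar (16 * K) - perimeter (16 * K) (mossinghoff (16 * K)) - 3 * PI ^ 4 / INR (16 * K) ^ 4)
    <= 105 * PI ^ 5 * (1 / INR (16 * K) ^ 5).
Proof.
  intros HK. destruct (better_angleP K HK) as (tm & H1 & H2 & _ & H4 & H5).
  rewrite (perimeter_mossinghoff K tm HK H5).
  replace 3 with (1 + 2) by ring.
  apply (perimeter_expansion K 2 tm mpat); auto; try lra.
  intros; apply defect_mpat; auto.
Qed.

Theorem theorem1 :
  exists A : nat -> polygon,
    (forall s : nat, (4 <= s)%nat ->
       convex_ngon (2 ^ s) (A (2 ^ s)%nat) /\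
       equilateral (2 ^ s) (A (2 ^ s)%nat) /\
       small (2 ^ s) (A (2 ^ s)%nat)) /\
    bigO_pow2
      (fun n => (Lbar n - perimeter n (A n)) - PI ^ 4 / INR n ^ 4)
      (fun n => 1 / INR n ^ 5) /\
    bigO_pow2
      (fun n => (perimeter n (A n) - perimeter n (mossinghoff n))
                - 2 * PI ^ 4 / INR n ^ 4)
      (fun n => 1 / INR n ^ 5) /\
    (forall s : nat, (4 <= s)%nat ->
       perimeter (2 ^ s) (A (2 ^ s)%nat)
       - perimeter (2 ^ s) (mossinghoff (2 ^ s)) > 0).
Proof.
  assert (Hpos : forall K, (1 <= K)%nat ->
            Rabs (1 / INR (16 * K) ^ 5) = 1 / INR (16 * K) ^ 5).
  { intros K HK. apply Rabs_pos_eq. left. apply Rdiv_lt_0_compat; [lra|].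
    apply pow_lt, lt_0_INR. lia. }
  exists better. split; [|split; [|split]].
  - intros s Hs. destruct (pow2_16 s Hs) as [-> HK]. set (K := (2 ^ (s - 4))%nat) in *.
    destruct (better_angleP K HK) as (tm & H1 & H2 & H3 & _).
    assert (Ht : 0 < better_angle K < PI / INR (16 * K)).
    { rewrite INR_16. pose proof PI_RGT_0. pose proof (le_INR _ _ HK) as HK'; simpl in HK'.
      assert (0 < PI / (16 * INR K + 2)) by (apply Rdiv_lt_0_compat; lra). lra. }
    rewrite better_16. destruct (sym_walk K pat _ HK Ht H3) as [eta W].
    split; [|split].
    + replace (16 * K)%nat with (2 * (8 * K - 1) + 2)%nat by lia.
      eapply ngon_convex; eauto. lia.
    + eexists. intros i Hi. now apply perimeter_sym.
    + replace (16 * K)%nat with (2 * (8 * K - 1) + 2)%nat by lia.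
      eapply ngon_small; eauto.
  - exists (105 * PI ^ 5), 4%nat. intros s Hs. destruct (pow2_16 s Hs) as [-> HK].
    rewrite Hpos by auto. now apply better_gap.
  - exists (210 * PI ^ 5), 4%nat. intros s Hs. destruct (pow2_16 s Hs) as [-> HK].
    (* The two gaps are subtracted: the leading coefficients give [3 - 1 = 2], the error constants
       add up to 210. *)
    rewrite Hpos by auto. set (K := (2 ^ (s - 4))%nat) in *.
    pose proof (better_gap K HK) as G1. pose proof (mossinghoff_gap K HK) as G2.
    match type of G1 with Rabs ?x <= _ => match type of G2 with Rabs ?y <= _ =>
      replace (_ - _ - _) with (y + - x) by (unfold Rdiv; ring); pose proof (Rabs_triang y (- x)) as T
    end end.
    rewrite Rabs_Ropp in T. lra.
  - intros s Hs. destruct (pow2_16 s Hs) as [-> HK]. set (K := (2 ^ (s - 4))%nat) in *.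
    rewrite better_perimeter by auto.
    destruct (better_angleP K HK) as (tm & H1 & H2 & H3 & _ & H5).
    rewrite (perimeter_mossinghoff K tm HK H5).
    pose proof PI_RGT_0. pose proof (le_INR _ _ HK) as HK'; simpl in HK'.
    assert (0 < PI / (16 * INR K + 2)) by (apply Rdiv_lt_0_compat; lra).
    destruct (angle_range K (better_angle K) HK ltac:(lra)) as [B _].
    pose proof PI2_3_2.
    assert (sin (tm / 2) < sin (better_angle K / 2)) by (apply sin_increasing_1; lra).
    rewrite INR_16. nra.
Qed.
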